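(* Let $\mathbf{k}$ be an algebraically closed field and let $V$ be a $\mathbf{k}$-vector space of dimension $n\geq 3$. Suppose that $\operatorname{char}(\mathbf{k})=0$ or $\operatorname{char}(\mathbf{k})\geq n-2$. Then the Cayley--Chow form $\mathfrak{Chow}(\mathbf{G})$ consists set-theoretically of those subspaces $K\subseteq\bigwedge^2V$ with $\dim(K)=2n-3$ satisfying $$\bigl(K\otimes\operatorname{Sym}^{n-3}V\bigr)\cap\operatorname{Ker}(\delta_{2,n-3})\neq 0$$ (intersection inside $\bigwedge^2V\otimes\operatorname{Sym}^{n-3}V$).
   Context: $\mathbf{G}=\operatorname{Gr}_2(V^\vee)\subseteq\mathbb{P}(\bigwedge^2V^\vee)$ is the Grassmannian of $2$-dimensional subspaces of $V^\vee$ in its Plücker embedding ($\mathbb{P}$ denotes one-dimensional subspaces). For $K\subseteq\bigwedge^2V$, $K^\perp\subseteq\bigwedge^2V^\vee$ denotes the kernel of the restriction map $\bigwedge^2V^\vee\to K^\vee$. The Cayley--Chow form of $\mathbf{G}$ is $$\mathfrak{Chow}(\mathbf{G})=\Bigl\{K\in\operatorname{Gr}_{2n-3}\bigl(\textstyle\bigwedge^2V\bigr):\ \mathbb{P}(K^\perp)\cap\mathbf{G}\neq\emptyset\Bigr\}.$$ The map $\delta_{2,q}:\bigwedge^2V\otimes\operatorname{Sym}^qV\to V\otimes\operatorname{Sym}^{q+1}V$ is the Koszul differential $(v\wedge w)\otimes f\mapsto v\otimes wf-w\otimes vf$ (up to sign). *)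

(* Defs.v *)
From HB Require Import structures.
From mathcomp Require Import all_boot all_order all_algebra ring.
From mathcomp Require Import mpoly.

Set Implicit Arguments.
Unset Strict Implicit.
Unset Printing Implicit Defensive.

Import GRing.Theory.
Local Open Scope ring_scope.

Notation vb V i := ((vbasis {:V})`_i).

Lemma linear_sumZ (k : fieldType) (A C : vectType k) (f : A -> C) :
  linear f -> forall (I : finType) (c : I -> k) (v : I -> A),
  f (\sum_i c i *: v i) = \sum_i c i *: f (v i).
Proof.
move=> fl I c v.
pose g : {linear A -> C} := HB.pack f (GRing.isLinear.Build k A C _ f fl).
rewrite -[f _]/(g _) linear_sum; apply: eq_bigr => i _.
by rewrite linearZ.
Qed.

Lemma linfunE (k : fieldType) (A C : vectType k) (f : A -> C) :
  linear f -> linfun f =1 f.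
Proof.
move=> fl; pose g : {linear A -> C} :=
  HB.pack f (GRing.isLinear.Build k A C _ f fl).
exact: (lfunE g).
Qed.

Section Bilinear.
Variables (k : fieldType) (A B C : vectType k).

Definition bilinear_map (b : A -> B -> C) : Prop :=
  (forall y, linear (b^~ y)) /\ (forall x, linear (b x)).

Lemma bilinear_coord b : bilinear_map b -> forall x y,
  b x y = \sum_i \sum_j
    (coord (vbasis {:A}) i x * coord (vbasis {:B}) j y) *: b (vb A i) (vb B j).
Proof.
move=> [bl br] x y.
rewrite {1}(coord_vbasis (memvf x)) {1}(coord_vbasis (memvf y)).
rewrite (linear_sumZ (bl _)) /=; apply: eq_bigr => i _.
rewrite (linear_sumZ (br _)) scaler_sumr; apply: eq_bigr => j _.
by rewrite scalerA.
Qed.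

End Bilinear.

Definition alternating (k : fieldType) (A C : vectType k) (b : A -> A -> C) :
  Prop := forall x, b x x = 0.

Definition dual (k : fieldType) (V : vectType k) : vectType k := 'Hom(V, k^o).

(* A (x) B, in coordinates with respect to the bases chosen by the library. *)
Definition tens (k : fieldType) (A B : vectType k) : Type :=
  'M[k]_(\dim {:A}, \dim {:B}).

HB.instance Definition _ (k : fieldType) (A B : vectType k) :=
  Vector.on (tens A B).

Section Tensor.
Variables (k : fieldType) (A B : vectType k).

Definition tensor (a : A) (b : B) : tens A B :=
  \matrix_(i, j) (coord (vbasis {:A}) i a * coord (vbasis {:B}) j b).

Definition tens_lift (C : vectType k) (f : A -> B -> C) : 'Hom(tens A B, C) :=
  linfun (fun t : tens A B => \sum_i \sum_j t i j *: f (vb A i) (vb B j)).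

Lemma tensor_bilinear : bilinear_map tensor.
Proof.
split=> [y c u v|x c u v]; apply/matrixP => i j; rewrite !mxE linearD linearZ /=.
  by rewrite mulrDl mulrA.
by rewrite mulrDr mulrCA.
Qed.

Lemma tens_liftE (C : vectType k) (f : A -> B -> C) :
  bilinear_map f -> forall a b, tens_lift f (tensor a b) = f a b.
Proof.
move=> [fl fr] a b.
pose g (t : tens A B) : C := \sum_i \sum_j t i j *: f (vb A i) (vb B j).
have gl : linear g.
  move=> c u v; rewrite /g scaler_sumr -big_split; apply: eq_bigr => i _ /=.
  rewrite scaler_sumr -big_split; apply: eq_bigr => j _ /=.
  by rewrite !mxE scalerDl scalerA.
rewrite /tens_lift (linfunE gl) /g [RHS](bilinear_coord (conj fl fr)).
by apply: eq_bigr => i _; apply: eq_bigr => j _; rewrite mxE.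
Qed.

Lemma tens_ext (C : vectType k) (f g : 'Hom(tens A B, C)) :
  (forall a b, f (tensor a b) = g (tensor a b)) -> f = g.
Proof.
move=> fg; apply/lfunP => t.
have -> : t = \sum_i \sum_j t i j *: tensor (vb A i) (vb B j).
  have fA := basis_free (vbasisP {:A}); have fB := basis_free (vbasisP {:B}).
  apply/matrixP => i j; rewrite summxE (bigD1 i) //= [X in _ + X]big1 => [|i' ni].
    rewrite addr0 summxE (bigD1 j) //= [X in _ + X]big1 => [|j' nj].
      by rewrite addr0 !mxE !coord_free // !eqxx !mulr1.
    by rewrite !mxE !coord_free // (negbTE nj) !mulr0.
  rewrite summxE big1 // => j' _.
  by rewrite !mxE !coord_free // (negbTE ni) mul0r mulr0.
rewrite !linear_sum; apply: eq_bigr => i _; rewrite !linear_sum.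
by apply: eq_bigr => j _; rewrite !linearZ /= fg.
Qed.

(* U (x) W as a subspace of A (x) B. *)
Definition tensv (U : {vspace A}) (W : {vspace B}) : {vspace tens A B} :=
  <<[seq tensor u w | u <- vbasis U, w <- vbasis W]>>%VS.

Lemma mem_tensv (U : {vspace A}) (W : {vspace B}) a b :
  a \in U -> b \in W -> tensor a b \in tensv U W.
Proof.
move=> aU bW; rewrite (coord_vbasis aU) (coord_vbasis bW).
rewrite (linear_sumZ (tensor_bilinear.1 _)); apply: memv_suml => i _.
rewrite (linear_sumZ (tensor_bilinear.2 _)); apply: memvZ.
apply: memv_suml => j _; apply/memvZ/memv_span/allpairs_f;
  by apply: mem_nth; rewrite size_tuple.
Qed.

End Tensor.

Lemma sum_pairs (n : nat) (C : zmodType) (F : 'I_n -> 'I_n -> C) :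
  (forall i, F i i = 0) ->
  \sum_i \sum_j F i j =
  \sum_(p : {p : 'I_n * 'I_n | (p.1 < p.2)%N})
    (F (val p).1 (val p).2 + F (val p).2 (val p).1).
Proof.
move=> F0; pose I := {p : 'I_n * 'I_n | (p.1 < p.2)%N}.
have sub (G : 'I_n * 'I_n -> C) :
    \sum_(p : I) G (val p) = \sum_(p : 'I_n * 'I_n | (p.1 < p.2)%N) G p.
  case: (pickP (fun p : 'I_n * 'I_n => (p.1 < p.2)%N)) => [p0 hp0|e].
    pose w p : I := insubd (Sub p0 hp0) p.
    rewrite (reindex_onto (val : I -> _) w) /= => [|p hp].
      apply: eq_bigl => p; rewrite (valP p) andTb; symmetry; apply/eqP.
      exact: valKd.
    by rewrite insubdK.
  rewrite [RHS]big_pred0; last exact: e.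
  by rewrite big1 // => p; move: (valP p); rewrite e.
rewrite big_split /= (sub (fun p => F p.1 p.2)) (sub (fun p => F p.2 p.1)).
rewrite pair_big /= (bigID (fun p : 'I_n * 'I_n => (p.1 < p.2)%N)) /=.
congr (_ + _).
rewrite (bigID (fun p : 'I_n * 'I_n => p.1 == p.2)) /= big1 => [|p]; last first.
  by case/andP => _ /eqP ->.
rewrite add0r (reindex_inj (h := fun p : 'I_n * 'I_n => (p.2, p.1))) /=.
  apply: eq_bigl => p /=.
  by rewrite -leqNgt -(inj_eq val_inj) ltn_neqAle andbC eq_sym.
by move=> [a b] [c d] [-> ->].
Qed.

(* The free vector space on the e_i /\ e_j with i < j. *)
Definition ext2 (k : fieldType) (V : vectType k) : Type :=
  {ffun {p : 'I_(\dim {:V}) * 'I_(\dim {:V}) | (p.1 < p.2)%N} -> k^o}.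

HB.instance Definition _ (k : fieldType) (V : vectType k) :=
  Vector.on (ext2 V).

Section Exterior.
Variables (k : fieldType) (V : vectType k).

Definition wedge (v w : V) : ext2 V :=
  let x i := coord (vbasis {:V}) i v in
  let y i := coord (vbasis {:V}) i w in
  [ffun p => x (val p).1 * y (val p).2 - x (val p).2 * y (val p).1].

Definition ext2_lift (C : vectType k) (f : V -> V -> C) : 'Hom(ext2 V, C) :=
  linfun (fun a : ext2 V => \sum_p a p *: f (vb V (val p).1) (vb V (val p).2)).

Lemma wedge_bilinear : bilinear_map wedge.
Proof.
split=> [y c u v|x c u v]; apply/ffunP => p;
  by rewrite !ffunE !linearD !linearZ /= /GRing.scale /=; ring.
Qed.

Lemma wedge_alternating : alternating wedge.
Proof. by move=> x; apply/ffunP => p; rewrite !ffunE mulrC subrr. Qed.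

Lemma ext2_liftE (C : vectType k) (f : V -> V -> C) :
  bilinear_map f -> alternating f ->
  forall v w, ext2_lift f (wedge v w) = f v w.
Proof.
move=> [fl fr] f0 v w.
pose g (a : ext2 V) : C := \sum_p a p *: f (vb V (val p).1) (vb V (val p).2).
have gl : linear g.
  move=> c x y; rewrite /g scaler_sumr -big_split; apply: eq_bigr => p _ /=.
  by rewrite !ffunE scalerDl scalerA.
have fN x y : f y x = - f x y.
  have fD := f0 (x + y); apply/eqP; rewrite -addr_eq0 -fD.
  have := fl (x + y) 1 x y; rewrite !scale1r => ->.
  have := fr x 1 x y; have := fr y 1 x y; rewrite !scale1r => -> ->.
  by rewrite !f0 add0r addr0 addrC.
rewrite /ext2_lift (linfunE gl) /g [RHS](bilinear_coord (conj fl fr)).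
rewrite sum_pairs => [|i]; last by rewrite f0 scaler0.
apply: eq_bigr => p _; rewrite ffunE [f (vb V (val p).2) _]fN scalerN -scalerBl.
by [].
Qed.

Lemma ext2_ext (C : vectType k) (f g : 'Hom(ext2 V, C)) :
  (forall v w, f (wedge v w) = g (wedge v w)) -> f = g.
Proof.
move=> fg; apply/lfunP => t.
have -> : t = \sum_p t p *: wedge (vb V (val p).1) (vb V (val p).2).
  have fV := basis_free (vbasisP {:V}).
  apply/ffunP => p; rewrite sum_ffunE (bigD1 p) //= [X in _ + X]big1 => [|q nq].
    rewrite addr0 !ffunE !coord_free // !eqxx.
    rewrite -![_ == _ :> 'I__](inj_eq val_inj) (ltn_eqF (valP p)).
    by rewrite eq_sym (ltn_eqF (valP p)) mulr0 subr0 !mulr1 /GRing.scale /= mulr1.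
  rewrite !ffunE !coord_free //; apply/eqP; rewrite scaler_eq0; apply/orP; right.
  rewrite -!natrM !mulnb subr_eq0.
  have -> : ((val q).1 == (val p).1) && ((val q).2 == (val p).2) = false.
    apply: contraNF nq => /andP[/eqP e1 /eqP e2]; apply/eqP/val_inj.
    by case: (val p) (val q) e1 e2 => [? ?] [? ?] /= -> ->.
  have -> : ((val q).1 == (val p).2) && ((val q).2 == (val p).1) = false.
    apply/negP => /andP[/eqP e1 /eqP e2]; move: (valP q).
    by rewrite e1 e2 ltnNge ltnW // (valP p).
  by [].
rewrite !linear_sum; apply: eq_bigr => p _.
by rewrite !linearZ /= fg.
Qed.

(* The image of /\^2 U in /\^2 V. *)
Definition ext2v (U : {vspace V}) : {vspace ext2 V} :=
  <<[seq wedge u w | u <- vbasis U, w <- vbasis U]>>%VS.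

Lemma mem_ext2v (U : {vspace V}) v w :
  v \in U -> w \in U -> wedge v w \in ext2v U.
Proof.
move=> vU wU; rewrite (coord_vbasis vU) (coord_vbasis wU).
rewrite (linear_sumZ (wedge_bilinear.1 _)); apply: memv_suml => i _.
rewrite (linear_sumZ (wedge_bilinear.2 _)); apply: memvZ.
apply: memv_suml => j _; apply/memvZ/memv_span/allpairs_f;
  by apply: mem_nth; rewrite size_tuple.
Qed.

End Exterior.

(* Sym^q V, as the degree q part of the polynomial ring on a basis of V. *)
Definition sym (k : fieldType) (q : nat) (V : vectType k) : Type :=
  dhomog (\dim {:V}) k q.

HB.instance Definition _ (k : fieldType) (q : nat) (V : vectType k) :=
  GRing.Lmodule.on (sym q V).

Section SymVect.
Variables (k : fieldType) (q : nat) (V : vectType k).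
Let n := \dim {:V}.
Let I := {m : 'X_{1..n < q.+1} | mdeg m == q}.
Let mon (i : 'I_#|{: I}|) : 'X_{1..n} := val (val (enum_val i)).

Lemma sym_vecaxiom : Vector.axiom #|{: I}| (sym q V).
Proof.
pose f (p : sym q V) : 'rV[k]_#|{: I}| := \row_i (val p)@_(mon i).
have monq i : mdeg (mon i) = q by apply/eqP; exact: (valP (enum_val i)).
pose h (r : 'rV[k]_#|{: I}|) : {mpoly k[n]} := \sum_i r 0 i *: 'X_[mon i].
have hP r : h r \is q.-homog.
  by apply: rpred_sum => i _; apply: rpredZ; rewrite dhomogX; apply/eqP/monq.
have mon_inj : injective mon.
  by move=> i j /val_inj /val_inj /enum_val_inj.
exists f.
  by move=> c p r; apply/rowP => i; rewrite !mxE /= mcoeffD mcoeffZ.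
exists (fun r => DHomog (hP r) : sym q V).
  move=> p; apply: val_inj; apply/mpolyP => m /=.
  rewrite /h raddf_sum /=.
  have [mq|mq] := eqVneq (mdeg m) q; last first.
    rewrite [RHS](dhomog_nemf_coeff (valP p) mq) big1 // => i _.
    rewrite mcoeffZ mcoeffX; case: eqP => [E|]; last by rewrite mulr0.
    by rewrite -E monq eqxx in mq.
  have mlt : (mdeg m < q.+1)%N by rewrite mq.
  have mq' : mdeg (BMultinom mlt) == q by rewrite /= mq.
  pose i0 : 'I_#|{: I}| := enum_rank (Sub (BMultinom mlt) mq' : I).
  have mi0 : mon i0 = m by rewrite /mon enum_rankK.
  rewrite (bigD1 i0) //= big1 ?addr0 => [|i ne].
    by rewrite mcoeffZ mcoeffX mxE mi0 eqxx mulr1.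
  rewrite mcoeffZ mcoeffX -mi0 (inj_eq mon_inj) (negbTE ne); exact: mulr0.
move=> r; apply/rowP => i; rewrite mxE /= /h raddf_sum (bigD1 i) //=.
rewrite big1 ?addr0 => [|j ne]; rewrite mcoeffZ mcoeffX.
  by rewrite eqxx mulr1.
by rewrite (inj_eq mon_inj) (negbTE ne) mulr0.
Qed.

HB.instance Definition _ :=
  Lmodule_hasFinDim.Build k (sym q V) sym_vecaxiom.

End SymVect.

Section SymMul.
Variables (k : fieldType) (V : vectType k).

Definition lin_form (v : V) : {mpoly k[\dim {:V}]} :=
  \sum_i coord (vbasis {:V}) i v *: 'X_i.

Lemma lin_form_homog v : lin_form v \is 1.-homog.
Proof.
by apply: rpred_sum => i _; apply: rpredZ; rewrite dhomogX; apply/eqP/mdeg1.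
Qed.

Definition symmul (q : nat) (v : V) (f : sym q V) : sym q.+1 V :=
  DHomog (dhomogM (lin_form_homog v) (dhomog_is_dhomog f)).

Lemma symmul_bilinear q : bilinear_map (@symmul q).
Proof.
split=> [f c u v|v c f g]; apply: val_inj => /=; last by rewrite mulrDr scalerAr.
rewrite scalerAl -mulrDl; congr (_ * _); rewrite scaler_sumr -big_split.
by apply: eq_bigr => i _ /=; rewrite linearD linearZ /= scalerDl scalerA.
Qed.

End SymMul.

Definition koszul (k : fieldType) (V : vectType k) (q : nat) (v w : V)
    (f : sym q V) : tens V (sym q.+1 V) :=
  tensor v (symmul w f) - tensor w (symmul v f).

(* delta_{2,q}; see [delta2_wedge] and [tens_ext], [ext2_ext]. *)
Definition delta2 (k : fieldType) (V : vectType k) (q : nat) :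
    'Hom(tens (ext2 V) (sym q V), tens V (sym q.+1 V)) :=
  tens_lift (fun a f =>
    ext2_lift (fun v w : V => linfun (@koszul k V q v w)) a f).

Lemma koszul_linear (k : fieldType) (V : vectType k) (q : nat) (v w : V) :
  linear (@koszul k V q v w).
Proof.
move=> c f g; rewrite /koszul !(symmul_bilinear _ _).2 !(tensor_bilinear _ _).2.
by rewrite scalerBr opprD addrACA.
Qed.

Lemma delta2_wedge (k : fieldType) (V : vectType k) (q : nat) (v w : V)
    (f : sym q V) :
  delta2 V q (tensor (wedge v w) f) =
  tensor v (symmul w f) - tensor w (symmul v f).
Proof.
have kl := @koszul_linear k V q.
rewrite /delta2 tens_liftE.
  rewrite ext2_liftE; first by rewrite linfunE.
    split=> [y c a b|y c a b]; apply/lfunP => g;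
      rewrite add_lfunE scale_lfunE !linfunE // /koszul.
      rewrite (symmul_bilinear _ _).1 (tensor_bilinear _ _).1.
      by rewrite (tensor_bilinear _ _).2 scalerBr opprD addrACA.
    rewrite (symmul_bilinear _ _).1 (tensor_bilinear _ _).1.
    by rewrite (tensor_bilinear _ _).2 scalerBr opprD addrACA.
  by move=> x; apply/lfunP => g; rewrite linfunE // /koszul subrr lfunE.
split=> [g c a b|a c x y]; last exact: linearP.
by rewrite linearP add_lfunE scale_lfunE.
Qed.

(* The natural map /\^2 (V^v) -> (/\^2 V)^v; see [ext2_pairing_wedge]. *)
Definition ext2_pairing (k : fieldType) (V : vectType k) :
    'Hom(ext2 (dual V), dual (ext2 V)) :=
  ext2_lift (fun x y : dual V =>
    (ext2_lift (fun v w : V => x v * y w - x w * y v : k^o) : dual (ext2 V))).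

Lemma ext2_pairing_wedge (k : fieldType) (V : vectType k) (x y : dual V)
    (v w : V) :
  ext2_pairing V (wedge x y) (wedge v w) = x v * y w - x w * y v.
Proof.
have det_bil (x' y' : dual V) :
    bilinear_map (fun v w : V => x' v * y' w - x' w * y' v : k^o).
  by split=> [z c a b|z c a b]; rewrite !linearP /= /GRing.scale /=; ring.
have det_alt (x' y' : dual V) :
    alternating (fun v w : V => x' v * y' w - x' w * y' v : k^o).
  by move=> z; rewrite subrr.
rewrite /ext2_pairing ext2_liftE; first by rewrite ext2_liftE.
  split=> [z c a b|z c a b]; apply: ext2_ext => v' w';
    rewrite add_lfunE scale_lfunE !ext2_liftE // !add_lfunE !scale_lfunE;
    by rewrite /GRing.scale /=; ring.
move=> z; apply: ext2_ext => v' w'; rewrite ext2_liftE // lfunE /=.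
by rewrite mulrC subrr.
Qed.

Section ChowForm.
Variables (k : fieldType) (V : vectType k).

(* The restriction map /\^2 (V^v) -> K^v. *)
Definition restr_dual (K : {vspace ext2 V}) :
    'Hom(ext2 (dual V), dual (subvs_of K)) :=
  linfun (fun x : ext2 (dual V) =>
    (ext2_pairing V x \o linfun (@vsval k (ext2 V) K))%VF : dual (subvs_of K)).

Definition orthv (K : {vspace ext2 V}) : {vspace ext2 (dual V)} :=
  lker (restr_dual K).

Lemma mem_orthv (K : {vspace ext2 V}) x :
  reflect (forall a, a \in K -> ext2_pairing V x a = 0) (x \in orthv K).
Proof.
have rE y (b : subvs_of K) : restr_dual K y b = ext2_pairing V y (vsval b).
  rewrite /restr_dual linfunE ?comp_lfunE ?lfunE // => c u v.
  apply/lfunP => a.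
  by rewrite add_lfunE scale_lfunE !comp_lfunE linearP add_lfunE scale_lfunE.
rewrite memv_ker; apply: (iffP eqP) => [x0 a aK|x0].
  by rewrite -(vsprojK aK) -rE x0 lfunE.
by apply/lfunP => b; rewrite rE lfunE x0 // subvsP.
Qed.

End ChowForm.

Definition Gr (k : fieldType) (W : vectType k) (d : nat) (U : {vspace W}) :
  pred {vspace W} := [pred L | (L <= U)%VS && (\dim L == d)].

Definition Proj (k : fieldType) (W : vectType k) (U : {vspace W}) :
  pred {vspace W} := Gr 1 U.

(* Gr_2(V^v) inside P(/\^2 V^v), by the Pluecker embedding U |-> /\^2 U. *)
Definition Grass (k : fieldType) (V : vectType k)
    (L : {vspace ext2 (dual V)}) : Prop :=
  exists2 U : {vspace dual V}, U \in Gr 2 {:dual V} & L = ext2v U.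

(* The Cayley-Chow form of Grass, as a set of subspaces. *)
Definition Chow (k : fieldType) (V : vectType k) (K : {vspace ext2 V}) : Prop :=
  K \in Gr (2 * \dim {:V} - 3) {:ext2 V} /\
  exists2 L, L \in Proj (orthv K) & Grass L.

(* Main.v *)
(* Let [r = 2n - 3] and [q = n - 3].  In terms of a basis of [K], the restriction
   of [delta_{2,q}] to [K (x) Sym V] is multiplication by an [r x n] matrix [T] of
   linear forms with [T x = 0], and [K] is outside the Chow form exactly when the
   kernel of [T(x)] is spanned by [x] for every [x <> 0].

   If [K] is in the Chow form, a point [xi /\ eta] of [P(K^perp)] yields the functional
   [v (x) f |-> eta(v) f(xi)], which vanishes on the image of [K (x) Sym^q V] but not
   on the kernel of [V (x) Sym^(q+1) V -> Sym^(q+2) V].  This kernel contains the image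
   and has dimension [r * dim Sym^q V], so [delta_{2,q}] is not injective on
   [K (x) Sym^q V].

   Conversely, let [K] be outside the Chow form and [om T = 0] with [om] of degree [q].
   The rows of [T] are commuting derivations [D_a = \sum_i T_ai d/d(eps_i)] of
   [S[eps_0, ..., eps_(n-1)]], [S = Sym V], which kill the tautological element
   [\sum_i x_i eps_i]; they define a de Rham complex.  Modulo the tautological element,
   [x_l] times a minor of [T] times the Euler field is a combination of the [D_a], so
   Cartan's formula gives homotopies whose eigenvalues on forms of degree [q] are
   multiples of [1, ..., q], which are invertible by the assumption on the
   characteristic.  By the Nullstellensatz the minors generate powers of all variables,
   so large powers of the [x_j] annihilate the cohomology; as they form a regular
   sequence, closed forms of total degree [q] are exact.  Apply this to the form
   [s |-> det(om, e_s, e_f)], made independent of the chart [f] by a partition of unity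
   for a power of [x_0].  Exact forms vanish on vectors annihilated by [T], and a
   comparison of degrees shows that all these determinants vanish, hence [om = 0]. *)

From Stdlib Require Import Classical.
Require Import Defs.
From HB Require Import structures.
From mathcomp Require Import all_boot all_order all_algebra.
From mathcomp Require Import ring zify.
From mathcomp Require Import mpoly.

Set Implicit Arguments.
Unset Strict Implicit.
Unset Printing Implicit Defensive.
Import GRing.Theory.
Local Open Scope ring_scope.

(** * De Rham complexes of commuting derivations *)

Section Cochains.
Variables (S : comNzRingType) (n r : nat) (T : 'M[S]_(r, n)).
Implicit Types (p u : {mpoly S[n]}) (psi phi : seq 'I_r -> {mpoly S[n]}).

Definition vfield (a : 'I_r) p : {mpoly S[n]} := \sum_i T a i *: p^`M(i).

Lemma vfield_is_linear a : linear (vfield a).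
Proof.
move=> c p q; rewrite /vfield scaler_sumr -big_split /=; apply: eq_bigr => i _.
by rewrite mderivD mderivZ scalerDr !scalerA mulrC.
Qed.

HB.instance Definition _ a :=
  GRing.isLinear.Build S {mpoly S[n]} {mpoly S[n]} _ (vfield a)
    (vfield_is_linear a).

Lemma vfieldM a p u : vfield a (p * u) = vfield a p * u + p * vfield a u.
Proof.
rewrite /vfield mulr_suml mulr_sumr -big_split /=; apply: eq_bigr => i _.
by rewrite mderivM scalerDr scalerAl scalerAr.
Qed.

(** The coefficients [T a i] are constants for the derivations, so this reduces to the commutation
    of partial derivatives. *)
Lemma vfieldC a b p : vfield a (vfield b p) = vfield b (vfield a p).
Proof.
have e c d : vfield c (vfield d p) =
    \sum_i \sum_j (T c i * T d j) *: p^`M(j)^`M(i).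
  rewrite {1}/vfield; apply: eq_bigr => i _.
  rewrite /vfield [X in _ *: X]linear_sum scaler_sumr; apply: eq_bigr => j _.
  by rewrite /= mderivZ scalerA.
rewrite !e exchange_big; apply: eq_bigr => j _; apply: eq_bigr => i _ /=.
by rewrite mulrC mderiv_comm.
Qed.

Lemma vfield_homog0 a p : p \is 0.-homog -> vfield a p = 0.
Proof.
move=> /dhomogP hp; apply: big1 => i _.
suff -> : p^`M(i) = 0 by rewrite scaler0.
apply/mpolyP => m; rewrite mcoeff_deriv mcoeff0 memN_msupp_eq0 ?mul0rn //.
by apply: contraT; rewrite negbK => /hp; rewrite /= mdegD mdeg1 addn1.
Qed.

(* The de Rham differential [(psi, s) |-> \sum_j (-1)^j D_{s_j} psi (s minus s_j)]
   on forms whose arguments are basis vectors of [K]. *)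
Fixpoint cobd psi (s : seq 'I_r) : {mpoly S[n]} :=
  if s is a :: t then vfield a (psi t) - cobd (fun v => psi (a :: v)) t else 0.

Lemma cobd_ext psi phi s :
  (forall t, (size t).+1 = size s -> psi t = phi t) -> cobd psi s = cobd phi s.
Proof.
elim: s psi phi => //= a s IH psi phi e; rewrite e //; congr (_ - _).
by apply: IH => t st; apply: e => /=; rewrite st.
Qed.

Lemma cobdP c psi phi s :
  cobd (fun t => c *: psi t + phi t) s = c *: cobd psi s + cobd phi s.
Proof.
elim: s psi phi => /= [|a s IH] psi phi; first by rewrite scaler0 addr0.
by rewrite linearP IH scalerBr opprD addrACA.
Qed.

Lemma cobd0 s : cobd (fun=> 0) s = 0.
Proof. by elim: s => //= a s ->; rewrite linear0 subr0. Qed.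

Lemma cobdZ c psi s : cobd (fun t => c *: psi t) s = c *: cobd psi s.
Proof.
rewrite -[RHS]addr0 -[X in _ = _ + X](cobd0 s) -cobdP.
by apply: cobd_ext => t _; rewrite addr0.
Qed.

Lemma cobdD psi phi s : cobd (fun t => psi t + phi t) s = cobd psi s + cobd phi s.
Proof.
rewrite -[cobd psi s]scale1r -cobdP.
by apply: cobd_ext => t _; rewrite scale1r.
Qed.

Lemma cobdB psi phi s : cobd (fun t => psi t - phi t) s = cobd psi s - cobd phi s.
Proof.
by rewrite cobdD -[- cobd phi s]scaleN1r -cobdZ; congr (_ + _);
  apply: cobd_ext => t _; rewrite scaleN1r.
Qed.

Lemma cobd_sum (I : Type) (l : seq I) (F : I -> seq 'I_r -> {mpoly S[n]}) s :
  cobd (fun t => \sum_(b <- l) F b t) s = \sum_(b <- l) cobd (F b) s.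
Proof.
elim: l => [|b l IH].
  by rewrite big_nil -[RHS](cobd0 s); apply: cobd_ext => t; rewrite big_nil.
rewrite big_cons -IH -cobdD; apply: cobd_ext => t _; exact: big_cons.
Qed.

Lemma cobd_vfield a psi s :
  cobd (fun t => vfield a (psi t)) s = vfield a (cobd psi s).
Proof.
elim: s psi => /= [|b s IH] psi; first by rewrite linear0.
by rewrite IH linearB /= vfieldC.
Qed.

Lemma cobd_cobd psi s : cobd (cobd psi) s = 0.
Proof.
elim: s psi => //= a s IH psi.
by rewrite cobdB IH cobd_vfield subr0 subrr.
Qed.

Lemma cobd_homog0 psi s : (forall t, psi t \is 0.-homog) -> cobd psi s = 0.
Proof.
elim: s psi => //= a s IH psi h.
by rewrite vfield_homog0 // IH ?subr0.
Qed.

Lemma cobd_closed (J : {mpoly S[n]} -> Prop) psi s :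
    J 0 -> (forall p u, J p -> J u -> J (p - u)) ->
    (forall a p, J p -> J (vfield a p)) ->
    (forall t, (size t).+1 = size s -> J (psi t)) -> J (cobd psi s).
Proof.
move=> J0 JB JD; elim: s psi => //= a s IH psi h.
by apply: JB; [apply/JD/h | apply: IH => t st; apply: h => /=; rewrite st].
Qed.

(** The form du /\ psi, which is the term of the Leibniz rule for u psi in which u is differentiated
    (see [cobd_mul]). *)
Fixpoint wedge_d u psi (s : seq 'I_r) : {mpoly S[n]} :=
  if s is a :: t then vfield a u * psi t - wedge_d u (fun v => psi (a :: v)) t
  else 0.

Lemma cobd_mul u psi s :
  cobd (fun t => u * psi t) s = wedge_d u psi s + u * cobd psi s.
Proof.
elim: s psi => /= [|a s IH] psi; first by rewrite mulr0 addr0.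
by rewrite IH vfieldM mulrBr opprD addrACA.
Qed.

Lemma wedge_dN u psi s : wedge_d u (fun t => - psi t) s = - wedge_d u psi s.
Proof.
by elim: s psi => /= [|a s IH] psi; rewrite ?oppr0 // IH mulrN opprB opprK addrC.
Qed.

Lemma wedge_d_ext u psi phi s :
  psi =1 phi -> wedge_d u psi s = wedge_d u phi s.
Proof.
elim: s psi phi => //= a s IH psi phi e; rewrite e; congr (_ - _).
by apply: IH => t; apply: e.
Qed.

Definition skew psi := forall s1 a b s2,
  psi (s1 ++ a :: b :: s2) = - psi (s1 ++ b :: a :: s2).

Lemma skew_cons psi a : skew psi -> skew (fun s => psi (a :: s)).
Proof. by move=> h s1 b c s2; apply: (h (a :: s1)). Qed.

Lemma skew_lin (c : S) psi phi : skew psi -> skew phi ->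
  skew (fun s => c *: psi s + phi s).
Proof. by move=> h1 h2 s1 a b s2; rewrite h1 h2 scalerN opprD. Qed.

(* The derivation extending [P] to multilinear forms. *)
Fixpoint subst_op (P : 'M[S]_r) psi (s : seq 'I_r) : {mpoly S[n]} :=
  if s is a :: t then
    \sum_b P a b *: psi (b :: t) + subst_op P (fun v => psi (a :: v)) t
  else 0.

Lemma skew_subst P psi : skew psi -> skew (subst_op P psi).
Proof.
move=> h s1 a b s2; elim: s1 psi h => /= [|c s1 IH] psi h.
  have -> : subst_op P (fun v => psi (a :: b :: v)) s2 =
            - subst_op P (fun v => psi (b :: a :: v)) s2.
    have sN phi chi : (forall v, phi v = - chi v) ->
        subst_op P phi s2 = - subst_op P chi s2.
      elim: s2 phi chi => /= [|c s IH] phi chi e; first by rewrite oppr0.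
      rewrite opprD -sumrN; congr (_ + _); last by apply: IH => v; apply: e.
      by apply: eq_bigr => i _; rewrite e scalerN.
    by apply: sN; apply: (h [::]).
  have swap c d : \sum_i P c i *: psi [:: i, d & s2] =
                  - \sum_i P c i *: psi [:: d, i & s2].
    by rewrite -sumrN; apply: eq_bigr => i _; rewrite (h [::]) scalerN.
  by rewrite !swap; ring.
rewrite opprD -sumrN; congr (_ + _); last by apply: IH; apply: skew_cons.
by apply: eq_bigr => i _; rewrite (h (i :: s1)) scalerN.
Qed.

Lemma subst_closed (J : {mpoly S[n]} -> Prop) P psi s :
    J 0 -> (forall p u, J p -> J u -> J (p + u)) ->
    (forall c p, J p -> J (c *: p)) ->
    (forall t, size t = size s -> J (psi t)) -> J (subst_op P psi s).
Proof.
move=> J0 JD JZ; elim: s psi => //= a s IH psi h; apply: (JD).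
  by apply: (big_ind J J0 JD) => b _; apply/JZ/h.
by apply: IH => t st; apply: h => /=; rewrite st.
Qed.

Variables (p : nat) (f : 'I_p -> 'I_r) (w : 'I_p -> {mpoly S[n]}).

(** Interior product with the vector field \sum_b w_b D_{f b}. *)
Definition contr psi (s : seq 'I_r) := \sum_b w b * psi (f b :: s).

Lemma skew_contr psi : skew psi -> skew (contr psi).
Proof.
move=> h s1 a b s2; rewrite /contr -sumrN; apply: eq_bigr => c _.
by rewrite (h (f c :: s1)) mulrN.
Qed.

Lemma contr_homog b psi s :
  (forall i, w i \is 1.-homog) -> (forall t, psi t \is b.-homog) ->
  contr psi s \is b.+1.-homog.
Proof. by move=> hw h; apply: rpred_sum => i _; rewrite -add1n dhomogM. Qed.

(* Cartan's formula for the Lie derivative along the field [\sum_b w b * D_{f b}],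
   where [P a c] is the derivative [D_a] of its [c]-th coefficient. *)
Lemma cartan (P : 'M[S]_r) psi s : skew psi ->
  (forall a t, \sum_b vfield a (w b) * psi (f b :: t) =
               \sum_c P a c *: psi (c :: t)) ->
  cobd (contr psi) s + contr (cobd psi) s =
  \sum_b w b * vfield (f b) (psi s) + subst_op P psi s.
Proof.
move=> sk hP; rewrite {1}/contr cobd_sum {1}/contr.
(* The terms w_b cobd(psi(f b :: .)) of the Leibniz rule cancel against the tails of
   [cobd psi (f b :: s)]. There remain the directional derivative and the forms dw_b /\ psi(f b ::
   .), whose sum the induction on [s] identifies with [subst_op P psi]. *)
under eq_bigr do rewrite cobd_mul.
rewrite big_split /= -addrA -big_split /=.
under [X in _ + X]eq_bigr do rewrite -mulrDr addrC subrK.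
rewrite addrC; congr (_ + _).
elim: s psi sk hP => /= [|a s IH] psi sk hP; first by rewrite big1.
rewrite big_split /= hP; congr (_ + _).
rewrite -IH; last 2 first.
- exact: skew_cons.
- move=> c t; transitivity (- \sum_b vfield c (w b) * psi [:: f b, a & t]).
    by rewrite -sumrN; apply: eq_bigr => b _; rewrite (sk [::]) mulrN.
  by rewrite hP -sumrN; apply: eq_bigr => b _; rewrite (sk [::]) scalerN opprK.
apply: eq_bigr => b _; rewrite -wedge_dN; apply: wedge_d_ext => t.
by rewrite (sk [::]) opprK.
Qed.

End Cochains.

(** * Multilinear extension of forms and evaluation on eigenvectors *)

Section MultilinearExtension.
Variables (S : comNzRingType) (n r : nat).
Implicit Types (psi phi : seq 'I_r -> {mpoly S[n]}).

Fixpoint mlin psi (ws : seq 'rV[S]_r) : {mpoly S[n]} :=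
  if ws is v :: ws' then \sum_a v 0 a *: mlin (fun t => psi (a :: t)) ws'
  else psi [::].

Lemma mlin_ext psi phi ws :
  (forall t, size t = size ws -> psi t = phi t) -> mlin psi ws = mlin phi ws.
Proof.
elim: ws psi phi => /= [|v ws IH] psi phi e; first exact: e.
apply: eq_bigr => a _; congr (_ *: _); apply: IH => t st; apply: e.
by rewrite /= st.
Qed.

Lemma mlinP c psi phi ws :
  mlin (fun t => c *: psi t + phi t) ws = c *: mlin psi ws + mlin phi ws.
Proof.
elim: ws psi phi => //= v ws IH psi phi.
rewrite scaler_sumr -big_split /=; apply: eq_bigr => a _.
by rewrite IH scalerDr !scalerA mulrC.
Qed.

Lemma mlin0 ws : mlin (fun=> 0) ws = 0.
Proof. by elim: ws => //= v ws IH; rewrite big1 // => a _; rewrite IH scaler0. Qed.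

Lemma mlin_sum (I : Type) (l : seq I) (c : I -> S) F ws :
  mlin (fun t => \sum_(b <- l) c b *: F b t) ws = \sum_(b <- l) c b *: mlin (F b) ws.
Proof.
elim: l => [|b l IH].
  by rewrite big_nil -[RHS](mlin0 ws); apply: mlin_ext => t; rewrite big_nil.
by rewrite big_cons -IH -mlinP; apply: mlin_ext => t _; rewrite big_cons.
Qed.

Lemma mlinZ c psi ws : mlin (fun t => c *: psi t) ws = c *: mlin psi ws.
Proof.
rewrite -[RHS]addr0 -[X in _ = _ + X](mlin0 ws) -mlinP.
by apply: mlin_ext => t _; rewrite addr0.
Qed.

Variables (P : 'M[S]_r) (d : S).
Hypothesis PP : P *m P = d *: P.

(* [P] has eigenvalues [0] and [d]; the vectors [d * e_a] split along them. *)
Definition eigvec (x : bool * 'I_r) : 'rV[S]_r :=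
  if x.1 then row x.2 P else d *: delta_mx 0 x.2 - row x.2 P.

Lemma eigvecP x : eigvec x *m P = (d * x.1%:R) *: eigvec x.
Proof.
case: x => [[] a]; rewrite /eigvec /= -?rowE.
  by rewrite -row_mul PP mulr1; apply/rowP => j; rewrite !mxE.
rewrite mulmxBl -scalemxAl -rowE -row_mul PP mulr0 scale0r.
by apply/rowP => j; rewrite !mxE subrr.
Qed.

(** A derivation acts on a tuple of eigenvectors by the sum of their eigenvalues, here [d] times the
    number of arguments with eigenvalue [d]. *)
Lemma mlin_subst psi xs :
  mlin (subst_op P psi) (map eigvec xs) =
  (d * (\sum_(x <- xs) x.1)%:R) *: mlin psi (map eigvec xs).
Proof.
elim: xs psi => [|x xs IH] psi; first by rewrite big_nil mulr0 scale0r.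
rewrite big_cons /=.
under eq_bigr => a _.
  rewrite -(mlin_ext (psi := fun t => 1 *: (\sum_b P a b *: psi (b :: t)) +
    subst_op P (fun v => psi (a :: v)) t)); last by move=> t _; rewrite scale1r.
  rewrite mlinP mlin_sum scale1r IH scalerDr; over.
rewrite big_split /= natrD mulrDr scalerDl; congr (_ + _).
  under eq_bigr do rewrite scaler_sumr.
  rewrite exchange_big scaler_sumr /=; apply: eq_bigr => b _.
  under eq_bigr do rewrite scalerA.
  rewrite -scaler_suml scalerA; congr (_ *: _).
  by have /rowP/(_ b) := eigvecP x; rewrite !mxE => <-.
by rewrite scaler_sumr; apply: eq_bigr => a _; rewrite !scalerA mulrC.
Qed.

(** Each d e_a is the sum of the two eigenvectors attached to a, so expanding all m arguments at the
    cost of d^m reduces membership in [J] to tuples of eigenvectors. *)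
Lemma eigvec_span (J : {mpoly S[n]} -> Prop) psi m :
    (forall p u, J p -> J u -> J (p + u)) ->
    (forall xs, size xs = m -> J (mlin psi (map eigvec xs))) ->
  forall s, size s = m -> J (d ^+ m *: psi s).
Proof.
move=> JD; elim: m psi => [|m IH] psi h [|a s] //=.
  by move=> _; rewrite expr0 scale1r; apply: (h [::]).
move=> [sm].
have -> : d ^+ m.+1 *: psi (a :: s) =
    d ^+ m *: (\sum_b eigvec (true, a) 0 b *: psi (b :: s)) +
    d ^+ m *: (\sum_b eigvec (false, a) 0 b *: psi (b :: s)).
  rewrite -scalerDr -big_split /= exprSr -scalerA; congr (_ *: _).
  have e b : eigvec (true, a) 0 b + eigvec (false, a) 0 b = d * (b == a)%:R.
    by rewrite !mxE eqxx /=; ring.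
  under eq_bigr do rewrite -scalerDl e.
  rewrite (bigD1 a) //= eqxx mulr1 big1 ?addr0 // => b /negbTE ->.
  by rewrite mulr0 scale0r.
have hc c : J (d ^+ m *: (\sum_b eigvec (c, a) 0 b *: psi (b :: s))).
  apply: (IH (fun t => \sum_b eigvec (c, a) 0 b *: psi (b :: t))) => // xs sx.
  by rewrite mlin_sum; apply: (h ((c, a) :: xs)); rewrite /= sx.
exact: JD.
Qed.

End MultilinearExtension.

(** * Homotopies from Cartan's formula, modulo an ideal stable under the derivations *)

Section Homotopy.
Variables (S : comNzRingType) (n r : nat) (T : 'M[S]_(r, n)).
Variables (J : {mpoly S[n]} -> Prop).
Hypothesis J0 : J 0.
Hypothesis JB : forall p u, J p -> J u -> J (p - u).
Hypothesis JM : forall p u, J u -> J (p * u).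
Hypothesis Jv : forall a p, J p -> J (vfield T a p).

Lemma idealN p : J p -> J (- p).
Proof. by move=> Jp; rewrite -sub0r; apply: JB. Qed.

Lemma idealD p u : J p -> J u -> J (p + u).
Proof. by move=> Jp Ju; rewrite -[u]opprK; apply/JB/idealN. Qed.

Lemma idealZ c p : J p -> J (c *: p).
Proof. by rewrite -mul_mpolyC; apply: JM. Qed.

Definition is_form b (psi : seq 'I_r -> {mpoly S[n]}) :=
  skew psi /\ forall s, psi s \is b.-homog.

Lemma is_form_lin b c psi phi : is_form b psi -> is_form b phi ->
  is_form b (fun s => c *: psi s + phi s).
Proof.
move=> [s1 h1] [s2 h2]; split; first exact: skew_lin.
by move=> s; rewrite rpredD ?rpredZ.
Qed.

Definition exact_mod b m (psi : seq 'I_r -> {mpoly S[n]}) :=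
  exists2 th, is_form b.+1 th & forall s, size s = m -> J (psi s - cobd T th s).

Lemma exact_mod_lin b m c psi phi : exact_mod b m psi -> exact_mod b m phi ->
  exact_mod b m (fun s => c *: psi s + phi s).
Proof.
move=> [t1 f1 h1] [t2 f2 h2].
exists (fun s => c *: t1 s + t2 s); first exact: is_form_lin.
move=> s sm; rewrite cobdP opprD addrACA -scalerBr.
by apply: idealD; [apply/idealZ/h1 | apply: h2].
Qed.

Lemma exact_mod_ideal b m psi : (forall s, size s = m -> J (psi s)) ->
  exact_mod b m psi.
Proof.
move=> h; exists (fun=> 0).
  by split=> [s1 x y s2|s]; rewrite ?oppr0 ?rpred0.
by move=> s sm; rewrite cobd0 subr0; apply: h.
Qed.

Lemma exact_mod_ext b m psi phi : (forall s, psi s = phi s) ->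
  exact_mod b m psi -> exact_mod b m phi.
Proof. by move=> e [t ft ht]; exists t => // s sm; rewrite -e; apply: ht. Qed.

Lemma exact_modZ b m c psi : exact_mod b m psi ->
  exact_mod b m (fun s => c *: psi s).
Proof.
move=> h; apply: exact_mod_ext (exact_mod_lin c h (@exact_mod_ideal b m (fun=> 0) _)).
  by move=> s; rewrite /= addr0.
by [].
Qed.

Variables (p : nat) (f : 'I_p -> 'I_r) (w : 'I_p -> {mpoly S[n]}).
Variables (x : 'M[S]_(r, p)) (d : S).
Hypothesis w_homog : forall i, w i \is 1.-homog.
Hypothesis vw : forall a b, vfield T a (w b) = (x a b)%:MP.
Let P := x *m rowsub f 1%:M.
Hypothesis PP : P *m P = d *: P.
Hypothesis euler : forall b u, u \is b.-homog ->
  J (\sum_i w i * vfield T (f i) u - (b%:R * d) *: u).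

Lemma vfield_contr psi a t : \sum_b vfield T a (w b) * psi (f b :: t) =
                             \sum_c P a c *: psi (c :: t).
Proof.
under [RHS]eq_bigr do rewrite mxE scaler_suml.
rewrite exchange_big; apply: eq_bigr => b _ /=.
rewrite (bigD1 (f b)) //= !mxE eqxx mulr1 big1 ?addr0 => [|c ne].
  by rewrite vw mul_mpolyC.
by rewrite !mxE eq_sym (negbTE ne) mulr0 scale0r.
Qed.

Lemma is_form_contr b psi : is_form b psi -> is_form b.+1 (contr f w psi).
Proof.
by move=> [sk h]; split=> [|s]; [apply: skew_contr | apply: contr_homog].
Qed.

Lemma is_form_subst b psi : is_form b psi -> is_form b (subst_op P psi).
Proof.
move=> [sk h]; split=> [|s]; first exact: skew_subst.
apply: (subst_closed (J := fun u => u \is b.-homog)) => // [|u v|c u].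
- exact: rpred0.
- exact: rpredD.
- exact: rpredZ.
Qed.

(** By [euler], the directional derivative in Cartan's formula is multiplication by b d modulo
    [J]. *)
Lemma subst_mod b psi s : is_form b psi ->
  J (subst_op P psi s + (b%:R * d) *: psi s -
     (cobd T (contr f w psi) s + contr f w (cobd T psi) s)).
Proof.
move=> [sk h]; rewrite (cartan s sk (vfield_contr psi)).
rewrite [X in _ - X]addrC opprD addrACA subrr add0r -opprB.
exact/idealN/euler.
Qed.

Section Iteration.
Variables (b m c0 : nat) (psi : seq 'I_r -> {mpoly S[n]}).
Hypothesis psi_form : is_form b psi.
Hypothesis psi_closed : forall s, size s = m.+1 -> J (cobd T psi s).
Hypothesis c0_le1 : (c0 <= 1)%N.
Hypothesis inv_nat : forall i, (i < m.+1 - c0)%N ->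
  exists v : S, v * (b + c0 + i)%:R = 1.
Hypothesis psi_ker : (0 < c0)%N -> forall s, size s = m ->
  J (d *: mlin psi [seq eigvec P d (false, a) | a <- s]).

(* On [m] arguments the eigenvalues of [subst_op P] are [d * c] with [0 <= c <= m], so
   the product of the [subst_op P - d * c] vanishes up to powers of [d], while Cartan's
   formula makes each factor the scalar [- (b + c) * d] up to exact forms.  If
   [c0 = 1], the factor [c = 0] is replaced by the assumption [psi_ker]. *)
Fixpoint sieve i : seq 'I_r -> {mpoly S[n]} := if i is j.+1 then
    fun s => (- (c0 + j)%:R * d) *: sieve j s + subst_op P (sieve j) s
  else psi.

Lemma sieve_form i : is_form b (sieve i).
Proof.
by elim: i => // i IH; apply: is_form_lin => //; apply: is_form_subst.
Qed.

(** By Cartan's formula, [subst_op P chi] is congruent to contr(cobd chi) + cobd(contr chi) - b d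
    chi. The differential kills the middle term, and the other two stay in [J] because chi is closed
    modulo [J]. *)
Lemma sieve_closed i s : size s = m.+1 -> J (cobd T (sieve i) s).
Proof.
elim: i s => [|i IH] s sm; first exact: psi_closed.
rewrite cobdP; apply: idealD; first exact/idealZ/IH.
set chi := sieve i in IH *; have fchi : is_form b chi := sieve_form i.
pose u t := subst_op P chi t + (b%:R * d) *: chi t -
     (cobd T (contr f w chi) t + contr f w (cobd T chi) t).
have Ju t : J (u t) by apply: subst_mod.
have eu t : subst_op P chi t = u t + (contr f w (cobd T chi) t +
    (cobd T (contr f w chi) t - (b%:R * d) *: chi t)) by rewrite /u; ring.
move: u Ju eu => u Ju eu; rewrite -[cobd _ _ s]/(cobd T (subst_op P chi) s).
have -> : cobd T (subst_op P chi) s =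
    cobd T u s + cobd T (contr f w (cobd T chi)) s - (b%:R * d) *: cobd T chi s.
  rewrite (cobd_ext T (fun t _ => eu t)) cobdD cobdD cobdB cobd_cobd cobdZ.
  by rewrite sub0r addrA.
apply: JB; last exact/idealZ/IH.
apply: idealD; apply: cobd_closed => // t; rewrite sm => -[st].
rewrite /contr; apply: (big_ind J J0 idealD) => c _; apply/JM/IH.
by rewrite /= st.
Qed.

(** Adding (b + c0 + i) d cancels the shift - (c0 + i) d of the sieve and leaves [subst_op P] + b d,
    for which Cartan's formula provides the primitive [contr f w (sieve i)]. *)
Lemma sieve_step i :
  exact_mod b m (fun s => sieve i.+1 s + ((b + c0 + i)%:R * d) *: sieve i s).
Proof.
exists (contr f w (sieve i)); first exact/is_form_contr/sieve_form.
move=> s sm; have := subst_mod s (sieve_form i).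
set u := (X in J X) => Ju; rewrite /=.
have -> : (- (c0 + i)%:R * d) *: sieve i s + subst_op P (sieve i) s +
    ((b + c0 + i)%:R * d) *: sieve i s - cobd T (contr f w (sieve i)) s =
    u + contr f w (cobd T (sieve i)) s.
  have e : (b + c0 + i)%:R * d = b%:R * d + (c0 + i)%:R * d.
    by rewrite -addnA natrD mulrDl.
  by rewrite /u e scalerDl mulNr scaleNr; ring.
apply: idealD => //; apply: (big_ind J J0 idealD) => c _.
by apply/JM/sieve_closed; rewrite /= sm.
Qed.

Lemma mlin_sieve i xs : mlin (sieve i) (map (eigvec P d) xs) =
  (d ^+ i * \prod_(j < i) ((\sum_(y <- xs) y.1)%:R - (c0 + j)%:R)) *:
    mlin psi (map (eigvec P d) xs).
Proof.
elim: i => [|i IH]; first by rewrite big_ord0 mulr1 scale1r.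
rewrite /= mlinP mlin_subst // IH !scalerA -scalerDl big_ord_recr /= exprS.
by congr (_ *: _); ring.
Qed.

Lemma sieve_end s : size s = m -> J (d ^+ m.+1 *: sieve (m.+1 - c0) s).
Proof.
move=> sm; rewrite exprSr -scalerA.
apply: (eigvec_span (P := P) idealD (psi := fun t => d *: sieve _ t)) => // xs sx.
rewrite mlinZ mlin_sieve scalerA mulrC -scalerA.
(* If c >= c0 arguments have eigenvalue [d], the factor of index c - c0 of the product vanishes, as
   c <= m. Otherwise c0 = 1 and c = 0, which is the case of [psi_ker]. *)
have [lt|le] := ltnP (\sum_(y <- xs) y.1) c0; last first.
  set z := (X in X *: _); suff -> : z = 0 by rewrite scale0r.
  have lt : (\sum_(y <- xs) y.1 - c0 < m.+1 - c0)%N.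
    have : (\sum_(y <- xs) y.1 <= m)%N.
      rewrite -sx -sum1_size leq_sum // => y _; exact: leq_b1.
    move: le; lia.
  by rewrite /z (bigD1 (Ordinal lt)) //= subnKC // subrr mul0r mulr0.
apply: idealZ; have c01 : c0 = 1%N by lia.
have {lt} : (\sum_(y <- xs) y.1 == 0)%N by lia.
rewrite sum_nat_seq_eq0 => /allP x0.
have -> : map (eigvec P d) xs = [seq eigvec P d (false, a) | a <- map snd xs].
  rewrite -map_comp; apply/eq_in_map => -[y a] /x0 /=.
  by case: y.
by apply: psi_ker; rewrite ?c01 ?size_map.
Qed.

(** Going back from the end of the sieve to [psi], each step uses [sieve_step], inverts one of b +
    c0, ..., b + m and costs a factor [d]. The m + 1 factors of [sieve_end] and at most m + 1 steps
    give the exponent 2(m + 1). *)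
Lemma exact_mod_torsion : exact_mod b m (fun s => d ^+ m.+1.*2 *: psi s).
Proof.
pose k := (m.+1 - c0)%N.
have h i : (i <= k)%N -> exact_mod b m (fun s => d ^+ (m.+1 + i) *: sieve (k - i) s).
  elim: i => [|i IH] lik.
    by rewrite subn0 addn0; apply: exact_mod_ideal sieve_end.
  have lt : (k - i.+1 < m.+1 - c0)%N by rewrite -/k; lia.
  have [v hv] := inv_nat lt.
  have := exact_mod_lin (- 1) (IH (ltnW lik))
    (exact_modZ (d ^+ (m.+1 + i)) (sieve_step (k - i.+1))).
  move=> /(exact_modZ v); apply: exact_mod_ext => s.
  have -> : (k - i)%N = (k - i.+1).+1 by lia.
  move: (sieve (k - i.+1).+1 s) => y.
  rewrite scaleN1r addrC -scalerBr addrC addKr !scalerA addnS exprSr.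
  congr (_ *: _); rewrite -[RHS]mul1r -[X in _ = X * _]hv -!mulrA.
  by congr (_ * _); rewrite mulrCA.
have := exact_modZ (d ^+ (m.+1 - k)) (h k (leqnn k)).
apply: exact_mod_ext => s; rewrite subnn /= scalerA -exprD.
by congr (_ ^+ _ *: _); rewrite /k; lia.
Qed.

End Iteration.
End Homotopy.

(** * Removing torsion along a regular sequence *)

Section Descent.
Variables (S : comNzRingType) (n r : nat) (T : 'M[S]_(r, n)).
Variables (J : nat -> {mpoly S[n]} -> Prop) (X : nat -> S) (len : nat).
Hypothesis J0 : forall j, J j 0.
Hypothesis JB : forall j p u, J j p -> J j u -> J j (p - u).
Hypothesis JM : forall j p u, J j u -> J j (p * u).
Hypothesis Jv : forall j a p, J j p -> J j (vfield T a p).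
Hypothesis JS : forall j p,
  J j.+1 p <-> exists y, J j (p - X j *: y).
Hypothesis regular : forall j p, (j < len)%N -> J j (X j *: p) -> J j p.

(** Let X_j psi = d th modulo J_j. Then th is closed modulo J_{j+1}, so th = d xi + X_j eta modulo
    J_j by the last hypothesis. Since d d = 0, X_j (psi - d eta) lies in J_j, and regularity cancels
    X_j. *)
Lemma divide_exact j b m psi : (j < len)%N ->
    exact_mod T (J j) b m (fun s => X j *: psi s) ->
    (forall m' th, m = m'.+1 -> is_form b.+1 th ->
       (forall s, size s = m -> J j.+1 (cobd T th s)) ->
       exists xi, forall s, size s = m' -> J j.+1 (th s - cobd T xi s)) ->
  exists eta, forall s, size s = m -> J j (psi s - cobd T eta s).
Proof.
move=> jlen [th fth hth]; case: m hth => [|m] hth IH.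
  exists (fun=> 0) => s /size0nil ->; rewrite subr0; apply: regular => //.
  by have := hth [::] erefl; rewrite subr0.
have cth s : size s = m.+1 -> J j.+1 (cobd T th s).
  move=> sm; apply/JS; exists (psi s).
  by rewrite -opprB; apply: (idealN (J0 j) (@JB j)); apply: hth.
have [xi hxi] := IH m th erefl fth cth.
have hy s : size s = m -> exists y, J j (th s - cobd T xi s - X j *: y).
  by move=> /hxi/JS.
(* There are finitely many lists of the relevant length, so [eta] is chosen value by value; its
   default 0 on other lists is never read. *)
have [F hF] := fin_all_exists (fun t : m.-tuple 'I_r => hy _ (size_tuple t)).
pose eta s := oapp F 0 (insub s).
have eta_ok s : size s = m -> J j (th s - cobd T xi s - X j *: eta s).
  move=> sm; have sm' : size s == m by rewrite sm.
  by rewrite /eta insubT; apply: (hF (Tuple sm')).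
exists eta => s sm; apply: regular => //.
rewrite scalerBr -cobdZ.
have -> : X j *: psi s - cobd T (fun t => X j *: eta t) s =
   (X j *: psi s - cobd T th s) +
   cobd T (fun t => th t - cobd T xi t - X j *: eta t) s.
  by rewrite !cobdB cobd_cobd; ring.
apply: (idealD (J0 j) (@JB j)); first exact: hth.
apply: (cobd_closed (J0 j) (@JB j) (@Jv j)) => t.
by rewrite sm => -[]; apply: eta_ok.
Qed.

Variable q : nat.
Hypothesis torsion : forall j b m psi, (0 < b)%N -> (b + m = q)%N -> is_form b psi ->
  (forall s, size s = m.+1 -> J j (cobd T psi s)) ->
  exact_mod T (J j) b m (fun s => X j *: psi s).

(** Each division passes from (j, b, m) to (j + 1, b + 1, m - 1): it uses one more element of the
    regular sequence and keeps b + m = q. *)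
Lemma closed_exact j b m psi : (0 < b)%N -> (b + m = q)%N -> (j + m < len)%N ->
    is_form b psi -> (forall s, size s = m.+1 -> J j (cobd T psi s)) ->
  exists eta, forall s, size s = m -> J j (psi s - cobd T eta s).
Proof.
elim: m j b psi => [|m IH] j b psi b0 bm jm fpsi cpsi;
  have jlt : (j < len)%N by lia.
  by apply: divide_exact jlt (torsion b0 bm fpsi cpsi) _.
apply: divide_exact jlt (torsion b0 bm fpsi cpsi) _ => m' th [<-] fth cth.
by apply: (IH j.+1 b.+1) => //; lia.
Qed.

End Descent.

Lemma euler_homog (S : comNzRingType) n b (u : {mpoly S[n]}) :
  u \is b.-homog -> \sum_i 'X_i * u^`M(i) = b%:R *: u.
Proof.
move=> /dhomogP hu; rewrite [u]mpolyE scaler_sumr.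
under eq_bigr do rewrite linear_sum mulr_sumr.
rewrite exchange_big big_seq [RHS]big_seq; apply: eq_bigr => m /hu /= <-.
rewrite mdegE natr_sum scaler_suml; apply: eq_bigr => i _.
rewrite mderivZ mderivX -!scalerAr !scalerA mulrC.
have [->|mi] := posnP (m i); first by rewrite mul0r !scale0r.
by rewrite -mpolyXD addmC submK // lep1mP -lt0n.
Qed.

Lemma mderivXU (S : comNzRingType) n (i j : 'I_n) :
  ('X_j : {mpoly S[n]})^`M(i) = (j == i)%:R.
Proof.
rewrite mderivX mnm1E; case: eqP => [->|_]; last by rewrite scale0r.
by rewrite -{1}[U_(i)%MM]add0m addmK mpolyX0 scale1r.
Qed.

Lemma mderiv_lin_form (S : comNzRingType) n (c : 'I_n -> S) (i : 'I_n) :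
  (\sum_j c j *: 'X_j : {mpoly S[n]})^`M(i) = (c i)%:MP.
Proof.
rewrite (raddf_sum (mderiv i)) (bigD1 i) //= big1 => [|j /negbTE ne].
  by rewrite addr0 mderivZ mderivXU eqxx alg_mpolyC.
by rewrite mderivZ mderivXU ne scaler0.
Qed.

(** * Minors of the pencil *)

Section Minors.
Variables (S : comNzRingType) (r p : nat) (T : 'M[S]_(r, 1 + p)) (xv : 'cV[S]_(1 + p)).
Hypothesis Txv : T *m xv = 0.
Implicit Types (f : 'I_p -> 'I_r) (l : 'I_(1 + p)).

(** Bordering the rows [f] of [T] by a unit row makes the matrix square. Its determinant is the
    signed minor without column l (see [minorE]), and its adjugate provides the Euler field
    below. *)
Definition minor_mx f l : 'M[S]_(1 + p) :=
  col_mx (delta_mx 0 l : 'rV_(1 + p)) (rowsub f T).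

Definition minor f l := \det (minor_mx f l).

Lemma minor_mx_xv f l : minor_mx f l *m xv = col_mx ((xv l 0)%:M : 'M_1) 0.
Proof.
rewrite /minor_mx mul_col_mx -rowE mul_rowsub_mx Txv; congr (col_mx _ _).
  by apply/matrixP => i j; rewrite !ord1 !mxE eqxx mulr1n.
by apply/matrixP => i j; rewrite !mxE.
Qed.

Lemma minor_mx_row0 f l j : minor_mx f l 0 j = (j == l)%:R.
Proof.
have -> : (0 : 'I_(1 + p)) = lshift p (0 : 'I_1) by apply: val_inj.
by rewrite /minor_mx col_mxEu mxE.
Qed.

Lemma cofactor_minor f l i : cofactor (minor_mx f l) 0 i = minor f i.
Proof.
rewrite /minor (expand_det_row _ 0) (bigD1 i) //= minor_mx_row0 eqxx mul1r.
rewrite big1 ?addr0 => [|j /negbTE ne]; last by rewrite minor_mx_row0 ne mul0r.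
rewrite /cofactor; congr (_ * \det _); apply/matrixP => a b; rewrite !mxE.
by case: splitP => [[[|//] ?] /=|//].
Qed.

(** Cramer's rule: the adjugate is applied to [minor_mx f l *m xv], which is x_l times the first
    unit vector. Thus the minors of fixed rows are proportional to the kernel vector. *)
Lemma minor_xv f l i : xv l 0 * minor f i = minor f l * xv i 0.
Proof.
have /matrixP/(_ i 0) : \adj (minor_mx f l) *m (minor_mx f l *m xv) =
    \adj (minor_mx f l) *m col_mx ((xv l 0)%:M : 'M_1) 0 by rewrite minor_mx_xv.
rewrite mulmxA mul_adj_mx mul_scalar_mx mxE => ->.
rewrite mxE (bigD1 0) //= big1 => [|j jn].
  rewrite addr0 mxE cofactor_minor mulrC; congr (_ * _).
  have -> : (0 : 'I_(1 + p)) = lshift p (0 : 'I_1) by apply: val_inj.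
  by rewrite col_mxEu mxE.
rewrite [X in _ * X]mxE; case: splitP => [[[|//] ?] /= e|k e]; last first.
  by rewrite [X in _ * X]mxE mulr0.
by move: jn; rewrite -(inj_eq val_inj) /= e.
Qed.

Definition minor_adj f l : 'M[S]_(1 + p, p) :=
  rsubmx (\adj (minor_mx f l) : 'M_(1 + p, 1 + p)).

Lemma mul_minor_adj f l : rowsub f T *m minor_adj f l = (minor f l)%:M.
Proof.
have := mul_mx_adj (minor_mx f l).
rewrite -[\adj _](@hsubmxK _ (1 + p) 1 p) {1}/minor_mx mul_col_row => e.
have := congr1 (@drsubmx _ 1 p 1 p) e; rewrite block_mxKdr => ->.
by apply/matrixP => i j; rewrite !mxE (inj_eq (@rshift_inj _ _)).
Qed.

(** In the adjugate identity on the other side, the first column of the adjugate also contributes.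
    After multiplication by x_l it becomes the minor times [xv]. *)
Lemma minor_adj_mul f l :
  xv l 0 *: (minor_adj f l *m rowsub f T) =
  (xv l 0 * minor f l)%:M - minor f l *: (xv *m delta_mx 0 l).
Proof.
pose C := lsubmx (\adj (minor_mx f l) : 'M_(1 + p, 1 + p)).
have xC : xv l 0 *: C = minor f l *: xv.
  apply/matrixP => i j; rewrite !ord1 !mxE.
  have -> : lshift p (0 : 'I_1) = 0 by apply: val_inj.
  by rewrite cofactor_minor minor_xv.
have e : C *m delta_mx 0 l + minor_adj f l *m rowsub f T = (minor f l)%:M.
  by rewrite -mul_row_col hsubmxK mul_adj_mx.
rewrite -scale_scalar_mx -e scalerDr [X in _ = X + _ - _]scalemxAl xC.
rewrite -scalemxAl addrAC subrr.
by rewrite add0r.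
Qed.

Variables (f : 'I_p -> 'I_r) (l : 'I_(1 + p)).
Local Notation d := (xv l 0 * minor f l).
(** Up to the factor d, [proj_mx] projects row vectors onto the span of the unit vectors chosen by
    [f], along the left kernel of [T] (see [proj_mx_idem] and [eigvec_ker]). *)
Definition proj_coef : 'M[S]_(r, p) := xv l 0 *: (T *m minor_adj f l).
Definition proj_mx : 'M[S]_r := proj_coef *m rowsub f 1%:M.

Lemma rowsub1_mul m (A : 'M[S]_(r, m)) : rowsub f 1%:M *m A = rowsub f A.
Proof. by rewrite mul_rowsub_mx mul1mx. Qed.

Lemma proj_mx_idem : proj_mx *m proj_mx = d *: proj_mx.
Proof.
rewrite /proj_mx /proj_coef -!scalemxAl -scalemxAr -!mulmxA.
rewrite [rowsub f _ *m _]mulmxA rowsub1_mul [rowsub f T *m _]mulmxA mul_minor_adj.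
by rewrite mul_scalar_mx -!scalemxAr !scalerA mulrA mulrAC.
Qed.

Lemma proj_mx_T : proj_mx *m T = d *: T.
Proof.
rewrite /proj_mx /proj_coef -!scalemxAl -!mulmxA rowsub1_mul.
rewrite scalemxAr minor_adj_mul mulmxBr mul_mx_scalar -scalemxAr mulmxA Txv.
by rewrite mul0mx scaler0 subr0.
Qed.

Lemma eigvec_ker a : eigvec proj_mx d (false, a) *m T = 0.
Proof.
by rewrite /eigvec /= mulmxBl -scalemxAl -rowE -row_mul proj_mx_T linearZ subrr.
Qed.

Definition euler_coef (b : 'I_p) : {mpoly S[1 + p]} :=
  xv l 0 *: \sum_i minor_adj f l i b *: 'X_i.

Lemma euler_coef_homog b : euler_coef b \is 1.-homog.
Proof.
apply/rpredZ/rpred_sum => i _; apply: rpredZ.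
by rewrite dhomogX; apply/eqP/mdeg1.
Qed.

Lemma vfield_euler_coef a b : vfield T a (euler_coef b) = (proj_coef a b)%:MP.
Proof.
rewrite /proj_coef /vfield 2!mxE mulr_sumr rmorph_sum; apply: eq_bigr => i _.
rewrite mderivZ mderiv_lin_form -!mul_mpolyC -!mpolyCM; congr _%:MP.
by rewrite mulrCA.
Qed.

Definition tautological : {mpoly S[1 + p]} := \sum_i xv i 0 *: 'X_i.

Lemma vfield_tautological a : vfield T a tautological = 0.
Proof.
have /matrixP/(_ a 0) := Txv; rewrite !mxE => e.
rewrite /vfield -[RHS](mpolyC0 _ S) -e rmorph_sum; apply: eq_bigr => i _.
by rewrite mderiv_lin_form -mul_mpolyC -mpolyCM.
Qed.

(** By [minor_adj_mul], the field has matrix d I - minor xv e_l. The first part is d times the Euler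
    field; the part of rank one is the tautological element times the derivative in eps_l. *)
Lemma euler_field b u : u \is b.-homog ->
  \sum_c euler_coef c * vfield T (f c) u =
  (b%:R * d) *: u - minor f l *: (tautological * u^`M(l)).
Proof.
move=> hu; rewrite mulrC -scalerA -(euler_homog hu).
transitivity (\sum_i \sum_j
  (xv l 0 *: (minor_adj f l *m rowsub f T)) i j *: ('X_i * u^`M(j))).
  under eq_bigr do rewrite -scalerAl mulr_suml scaler_sumr.
  rewrite exchange_big; apply: eq_bigr => i _ /=.
  under eq_bigr do rewrite /vfield mulr_sumr scaler_sumr.
  rewrite exchange_big; apply: eq_bigr => j _ /=.
  rewrite !mxE mulr_sumr scaler_suml; apply: eq_bigr => c _.
  by rewrite [rowsub f T _ _]mxE -scalerAl -scalerAr !scalerA mulrA.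
have e i j : (xv l 0 *: (minor_adj f l *m rowsub f T)) i j =
    (i == j)%:R * d - (j == l)%:R * (minor f l * xv i 0).
  rewrite minor_adj_mul; move: (xv l 0 * minor f l) => y.
  by rewrite !mxE big_ord1 !mxE eqxx /= [_ * (j == l)%:R]mulrC mulrCA mulr_natl.
rewrite scaler_sumr mulr_suml scaler_sumr -sumrB; apply: eq_bigr => i _.
under eq_bigr do rewrite e scalerBl.
rewrite sumrB; congr (_ - _).
  rewrite (bigD1 i) //= eqxx mul1r big1 ?addr0 // => j ne.
  by rewrite eq_sym (negbTE ne) mul0r scale0r.
rewrite (bigD1 l) //= eqxx mul1r big1 ?addr0 => [|j /negbTE ->].
  by rewrite -scalerAl scalerA.
by rewrite mul0r scale0r.
Qed.

End Minors.

Lemma mcoeffXUM (R : comNzRingType) n (i : 'I_n) (p : {mpoly R[n]}) m :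
  ('X_i * p)@_m = if (0 < m i)%N then p@_(m - U_(i)) else 0.
Proof.
case: ifP => [mi|mi].
  have e : m = (U_(i) + (m - U_(i)))%MM by rewrite addmC submK // lep1mP -lt0n.
  by rewrite [in LHS]e mulrC mcoeffMX.
apply: memN_msupp_eq0; apply: contraFN mi => /msuppM_le/allpairsP[[a b] /=].
rewrite msuppX inE => -[/eqP -> _ ->].
by rewrite mnmDE mnm1E eqxx.
Qed.

(** * Regularity of powers of the variables *)

Section PowerIdeal.
Variables (R : comNzRingType) (n N : nat).
Local Notation S := {mpoly R[n.+1]}.
Implicit Types (s u : S) (j : nat).

(* The ideal of [X_0^N, ..., X_{j-1}^N]. *)
Definition low_ideal j s :=
  forall m, m \in msupp s -> exists2 i : 'I_n.+1, (i < j)%N & (N <= m i)%N.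

Lemma low_ideal0 j : low_ideal j 0.
Proof. by move=> m; rewrite msupp0. Qed.

Lemma low_idealD j s u : low_ideal j s -> low_ideal j u -> low_ideal j (s + u).
Proof.
by move=> hs hu m /msuppD_le; rewrite mem_cat => /orP[/hs|/hu].
Qed.

Lemma low_idealN j s : low_ideal j s -> low_ideal j (- s).
Proof. by move=> hs m; rewrite (perm_mem (msuppN s)) => /hs. Qed.

Lemma low_idealB j s u : low_ideal j s -> low_ideal j u -> low_ideal j (s - u).
Proof. by move=> hs hu; apply/low_idealD/low_idealN. Qed.

Lemma low_idealM j s u : low_ideal j u -> low_ideal j (s * u).
Proof.
move=> hu m /msuppM_le/allpairsP[[a b] /= [_ /hu[i ij Nb] ->]].
by exists i => //; rewrite mnmDE (leq_trans Nb) ?leq_addl.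
Qed.

Lemma low_ideal_sum j (I : Type) (l : seq I) (P : pred I) (F : I -> S) :
  (forall i, P i -> low_ideal j (F i)) -> low_ideal j (\sum_(i <- l | P i) F i).
Proof.
by move=> h; apply: big_ind => //; [apply: low_ideal0 | apply: low_idealD].
Qed.

Lemma low_idealS j s : low_ideal j s -> low_ideal j.+1 s.
Proof. by move=> hs m /hs[i ij h]; exists i => //; apply: ltnW. Qed.

(** Indexed by natural numbers, with value 0 beyond the last variable, to serve as the sequence of
    the descent. *)
Definition low_pow j : S := oapp (fun i : 'I_n.+1 => 'X_i ^+ N) 0 (insub j).

Lemma low_powE (i : 'I_n.+1) : low_pow i = 'X_[U_(i) *+ N].
Proof. by rewrite /low_pow valK /= mpolyXn. Qed.

Lemma low_ideal_pow j s : low_ideal j.+1 (low_pow j * s).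
Proof.
rewrite /low_pow; case: insubP => [i _ <-|_] /=; last first.
  by rewrite mul0r; apply: low_ideal0.
move=> m; rewrite mpolyXn => /msuppM_le/allpairsP[[a b] /=].
rewrite msuppX inE => -[/eqP -> _ ->]; exists i => //.
by rewrite mnmDE mulmnE mnm1E eqxx mul1n leq_addr.
Qed.

Lemma low_ideal_split j s : low_ideal j.+1 s ->
  exists u, low_ideal j (s - low_pow j * u).
Proof.
move=> hs; rewrite [s]mpolyE.
have h (m : 'X_{1..n.+1}) : m \in msupp s ->
    exists u, low_ideal j (s@_m *: 'X_[m] - low_pow j * u).
  move=> /hs [i]; rewrite ltnS leq_eqVlt => /orP[/eqP <-|ij] Nm.
    exists (s@_m *: 'X_[m - U_(i) *+ N]).
    rewrite low_powE -scalerAr -mpolyXD addmC submK ?subrr; first exact: low_ideal0.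
    apply/mnm_lepP => a; rewrite mulmnE mnm1E; case: eqP => [<-|_] //.
    by rewrite mul1n.
  exists 0; rewrite mulr0 subr0 => m' /msuppZ_le; rewrite msuppX inE => /eqP ->.
  by exists i.
rewrite big_seq; apply: (big_ind (fun v => exists u, low_ideal j (v - low_pow j * u))) => //.
  by exists 0; rewrite mulr0 subrr; apply: low_ideal0.
move=> v1 v2 [u1 h1] [u2 h2]; exists (u1 + u2).
by rewrite mulrDr opprD addrACA; apply: low_idealD.
Qed.

(** The ideal is generated by monomials in variables of index below j, so multiplication by a power
    of X_i cannot bring a monomial into it. *)
Lemma low_ideal_reg (j : nat) (i : 'I_n.+1) k s : (j <= i)%N ->
  low_ideal j ('X_i ^+ k * s) -> low_ideal j s.
Proof.
move=> ji h m ms.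
have := h (U_(i) *+ k + m)%MM; rewrite mpolyXn mcoeff_msupp mulrC mcoeffMX.
rewrite -mcoeff_msupp => /(_ ms) [a aj]; rewrite mnmDE mulmnE mnm1E.
by case: eqP aj => [<-|_ aj]; [rewrite ltnNge ji | rewrite mul0n => Na; exists a].
Qed.

(* The ideal of [X_0^N, ..., X_{j-1}^N] and of the tautological element in
   [S[eps_0, ..., eps_n]]. *)
Local Notation xv := (\col_i 'X_i : 'cV[S]_(1 + n)).
Local Notation taut := (tautological xv).
Definition coef_ideal j (p : {mpoly S[1 + n]}) := forall m, low_ideal j p@_m.
Definition taut_ideal j (p : {mpoly S[1 + n]}) :=
  exists c, coef_ideal j (p - taut * c).

Lemma coef_idealD j p q : coef_ideal j p -> coef_ideal j q -> coef_ideal j (p + q).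
Proof. by move=> hp hq m; rewrite mcoeffD; apply: low_idealD. Qed.

Lemma coef_idealB j p q : coef_ideal j p -> coef_ideal j q -> coef_ideal j (p - q).
Proof. by move=> hp hq m; rewrite mcoeffB; apply: low_idealB. Qed.

Lemma coef_ideal0 j : coef_ideal j 0.
Proof. by move=> m; rewrite mcoeff0; apply: low_ideal0. Qed.

Lemma coef_idealM j c p : coef_ideal j p -> coef_ideal j (c * p).
Proof.
move=> hp m; rewrite mcoeffM; apply: low_ideal_sum => a _.
exact: low_idealM.
Qed.

Lemma coef_ideal_split j p : coef_ideal j.+1 p ->
  exists u : {mpoly S[1 + n]}, coef_ideal j (p - low_pow j *: u).
Proof.
move=> hp; rewrite [p]mpolyE.
apply: (big_ind (fun v => exists u : {mpoly S[1 + n]}, coef_ideal j (v - low_pow j *: u)))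
  => [||m _].
- by exists 0; rewrite scaler0 subrr; apply: coef_ideal0.
- move=> v1 v2 [u1 h1] [u2 h2]; exists (u1 + u2).
  by rewrite scalerDr opprD addrACA; apply: coef_idealD.
have [u hu] := low_ideal_split (hp m); exists (u *: 'X_[m] : {mpoly S[1 + n]}) => a.
by rewrite scalerA -scalerBl mcoeffZ mulrC; apply: low_idealM.
Qed.

(** Descending induction on the exponent of eps_n: the coefficient of taut p at m + eps_n is X_n p_m
    plus multiples of coefficients of p with a larger exponent of eps_n, and X_n is regular modulo
    the ideal because j <= n. *)
Lemma coef_ideal_taut j p : (j <= n)%N ->
  coef_ideal j (taut * p) -> coef_ideal j p.
Proof.
move=> jn h; pose o : 'I_(1 + n) := ord_max.
suff H k (m : 'X_{1..1 + n}) : (msize p <= k + m o)%N -> low_ideal j p@_m.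
  by move=> m; apply: (H (msize p)); apply: leq_addr.
elim: k m => [|k IH] m hm.
  rewrite memN_msupp_eq0; first exact: low_ideal0.
  apply: msize_mdeg_ge; apply: leq_trans hm _.
  by rewrite add0n mdegE (bigD1 o) //= leq_addr.
apply: (@low_ideal_reg j o 1) => //; rewrite expr1.
have := h (m + U_(o))%MM.
rewrite /tautological mulr_suml raddf_sum (bigD1 o) //= mxE.
rewrite -scalerAl mcoeffZ mcoeffXUM mnmDE mnm1E eqxx addn1 addmK /=.
move=> hD; rewrite -[_ * _](addrK (\sum_(i < 1 + n | i != o)
  (xv i 0 *: 'X_i * p)@_(m + U_(o)))); apply: low_idealB => //.
apply: low_ideal_sum => i ne; rewrite -scalerAl mcoeffZ; apply: low_idealM.
rewrite mcoeffXUM; case: ifP => _; last exact: low_ideal0.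
apply: IH; rewrite mnmBE mnmDE !mnm1E eqxx (negbTE ne) subn0.
by rewrite addn1 addnS -addSn.
Qed.

Lemma taut_ideal0 j : taut_ideal j 0.
Proof. by exists 0; rewrite mulr0 subrr; apply: coef_ideal0. Qed.

Lemma taut_idealB j p q : taut_ideal j p -> taut_ideal j q -> taut_ideal j (p - q).
Proof.
move=> [c hc] [e he]; exists (c - e).
have -> : p - q - taut * (c - e) = (p - taut * c) - (q - taut * e) by ring.
exact: coef_idealB.
Qed.

Lemma taut_idealM j p q : taut_ideal j q -> taut_ideal j (p * q).
Proof.
by move=> [c hc]; exists (p * c); rewrite mulrCA -mulrBr; apply: coef_idealM.
Qed.

Lemma taut_ideal_taut j p : taut_ideal j (taut * p).
Proof. by exists p; rewrite subrr; apply: coef_ideal0. Qed.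

Lemma taut_ideal_vfield r (T : 'M[S]_(r, 1 + n)) j a p :
  T *m xv = 0 -> taut_ideal j p -> taut_ideal j (vfield T a p).
Proof.
move=> Tx [c hc]; exists (vfield T a c).
have -> : vfield T a p - taut * vfield T a c = vfield T a (p - taut * c).
  by rewrite linearB /= vfieldM vfield_tautological // mul0r add0r.
move=> m; rewrite raddf_sum; apply: low_ideal_sum => i _ /=.
rewrite mcoeffZ mcoeff_deriv; apply: low_idealM.
by rewrite -mulr_natl; apply: low_idealM.
Qed.

Lemma taut_idealS j p :
  taut_ideal j.+1 p <-> exists u : {mpoly S[1 + n]}, taut_ideal j (p - low_pow j *: u).
Proof.
split=> [[c /coef_ideal_split [u hu]]|[u [c hc]]].
  by exists u, c; rewrite addrAC.
exists c => m; have := low_idealS (hc m).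
rewrite addrAC mcoeffB mcoeffZ => h.
by rewrite -[_@_m](subrK (low_pow j * u@_m)); apply/low_idealD/low_ideal_pow.
Qed.

(** If X_j^N p = taut c modulo the first j powers, then taut c, and hence c, lies in the ideal of
    the first j + 1 powers. Writing c = X_j^N u allows X_j^N to be cancelled in X_j^N (p - taut
    u). *)
Lemma taut_ideal_reg j p : (j < n)%N ->
  taut_ideal j (low_pow j *: p) -> taut_ideal j p.
Proof.
move=> jn [c hc].
have h1 : coef_ideal j.+1 (taut * c).
  move=> m; rewrite -[_@_m](subKr (low_pow j *: p)@_m) -mcoeffB.
  apply: low_idealB; last exact/low_idealS/hc.
  by rewrite mcoeffZ; apply: low_ideal_pow.
have [u hu] := coef_ideal_split (coef_ideal_taut jn h1); exists u.
pose i : 'I_n.+1 := Ordinal (ltnW jn : (j < n.+1)%N) => m.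
apply: (@low_ideal_reg j i N) => //.
rewrite mpolyXn -low_powE -mcoeffZ.
have -> : low_pow i *: (p - taut * u) =
   (low_pow j *: p - taut * c) + taut * (c - low_pow j *: u).
  by rewrite scalerBr mulrBr -scalerAr addrA subrK.
rewrite mcoeffD; apply: low_idealD; [exact: hc | exact: coef_idealM].
Qed.

End PowerIdeal.

(** * The homogeneous Nullstellensatz *)

Section Ideals.
Variables (R : comNzRingType).
Implicit Types (A B : R -> Prop) (x p h : R).

Definition is_ideal A :=
  [/\ A 0, forall p q, A p -> A q -> A (p + q) & forall p q, A q -> A (p * q)].

Definition adjoin A x p := exists h, A (p - x * h).

Lemma adjoin_ideal A x : is_ideal A -> is_ideal (adjoin A x).
Proof.
move=> [A0 AD AM]; split=> [|p q [h hp] [h' hq]|p q [h hq]].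
- by exists 0; rewrite mulr0 subrr.
- by exists (h + h'); rewrite mulrDr opprD addrACA; apply: AD.
- by exists (p * h); rewrite mulrCA -mulrBr; apply: AM.
Qed.

Lemma sub_adjoin A x p : A p -> adjoin A x p.
Proof. by move=> Ap; exists 0; rewrite mulr0 subr0. Qed.

Lemma mem_adjoin A x : is_ideal A -> adjoin A x x.
Proof. by case=> A0 _ _; exists 1; rewrite mulr1 subrr. Qed.

Lemma ideal_opp A p : is_ideal A -> A p -> A (- p).
Proof. by move=> [_ _ AM] Ap; rewrite -mulN1r; apply: AM. Qed.

Lemma ideal_sub A p q : is_ideal A -> A p -> A q -> A (p - q).
Proof. by move=> iA Ap Aq; have [_ AD _] := iA; apply: AD (ideal_opp _ _). Qed.

Lemma ideal_sum A (I : Type) (l : seq I) (P : pred I) F : is_ideal A ->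
  (forall i, P i -> A (F i)) -> A (\sum_(i <- l | P i) F i).
Proof. by move=> [A0 AD _]; apply: big_ind. Qed.

(** If 1 lies in A + (z - a), the factor z - a can be removed from the product without leaving A;
    not all factors can be removed, as A is proper. *)
Lemma proper_adjoin A (z : R) (l : seq R) : is_ideal A -> ~ A 1 ->
    A (\prod_(a <- l) (z - a)) ->
  exists2 a, a \in l & ~ adjoin A (z - a) 1.
Proof.
move=> iA A1; have [_ AD AM] := iA; elim: l => [|a l IH].
  by rewrite big_nil.
rewrite big_cons => Az.
have [[h hh]|nA] := classic (adjoin A (z - a) 1); last by exists a; rewrite ?mem_head.
have [|b bl hb] := IH; last by exists b; rewrite ?in_cons ?bl ?orbT.
set P := \prod_(b <- l) _ in Az *.
have -> : P = P * (1 - (z - a) * h) + h * ((z - a) * P) by ring.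
by apply: AD; apply: AM.
Qed.

End Ideals.

Section Nullstellensatz.
Variables (k : closedFieldType) (n : nat).
Local Notation S := {mpoly k[n]}.
Implicit Types (A B : S -> Prop).

Lemma ideal_scale A c (p : S) : is_ideal A -> A p -> A (c *: p).
Proof. by move=> [_ _ AM]; rewrite -mul_mpolyC; apply: AM. Qed.

Definition algebraic_mod A (z : S) :=
  exists2 f : {poly k}, f != 0 & A (\sum_(i < size f) f`_i *: z ^+ i).

Lemma algebraic_root A (z : S) : is_ideal A -> ~ A 1 -> algebraic_mod A z ->
  exists a : k, ~ adjoin A (z - a%:MP) 1.
Proof.
move=> iA A1 [f f0].
have -> : \sum_(i < size f) f`_i *: z ^+ i = (map_poly (@mpolyC n k) f).[z].
  rewrite horner_coef size_map_poly_id0 ?mpolyC_eq0 ?lead_coef_eq0 //.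
  by apply: eq_bigr => i _; rewrite coef_map /= mul_mpolyC.
have [l ->] := closed_field_poly_normal f.
rewrite map_polyZ hornerZ mul_mpolyC => /(ideal_scale (lead_coef f)^-1 iA).
rewrite scalerA mulVf ?lead_coef_eq0 // scale1r rmorph_prod horner_prod.
have -> : \prod_(i <- l) (map_poly (@mpolyC n k) ('X - i%:P)).[z] =
          \prod_(a <- map (@mpolyC n k) l) (z - a).
  rewrite big_map; apply: eq_bigr => a _.
  by rewrite rmorphB /= map_polyX map_polyC !hornerE.
by move=> /(proper_adjoin iA A1) [_ /mapP[a _ ->]]; exists a.
Qed.

(** Some X_i - x_i is adjoined for every i, keeping the ideal proper by [algebraic_root]. Modulo the
    final ideal p is congruent to the constant p(x), which must vanish for p in A. *)
Lemma proper_zero A : is_ideal A -> ~ A 1 ->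
    (forall i, algebraic_mod A 'X_i) ->
  exists x : 'I_n -> k, forall p, A p -> p.@[x] = 0.
Proof.
move=> iA A1 alg.
have [B [iB B1 AB]] : exists B, [/\ is_ideal B, ~ B 1,
    forall p, A p -> B p & forall i, i \in enum 'I_n -> exists a, B ('X_i - a%:MP)].
  elim: (enum 'I_n) => [|i l [B [iB B1 AB hB]]]; first by exists A.
  have algB : algebraic_mod B 'X_i.
    by have [f f0 hf] := alg i; exists f => //; apply: AB.
  have [a ha] := algebraic_root iB B1 algB.
  exists (adjoin B ('X_i - a%:MP)); split=> //; first exact: adjoin_ideal.
    by move=> p /AB; apply: sub_adjoin.
  move=> j; rewrite in_cons => /orP[/eqP ->|/hB [b hb]].
    by exists a; apply: mem_adjoin.
  by exists b; apply: sub_adjoin.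
move=> hB; have {}hB i : exists a, B ('X_i - a%:MP) by apply: hB; rewrite mem_enum.
have {hB} [x hx] := fin_all_exists hB.
exists x => p /AB Bp; have [B0 BD BM] := iB.
suff E (q : S) : B (q - (q.@[x])%:MP).
  apply/eqP; apply/negPn/negP => p0; apply: B1.
  have -> : 1 = p.@[x]^-1 *: (p - (p - (p.@[x])%:MP)) :> S.
    by rewrite opprB addrC subrK -mul_mpolyC -mpolyCM mulVf.
  by apply: (ideal_scale _ iB); apply: ideal_sub; last exact: E.
have EM (u v : S) : B (u - (u.@[x])%:MP) -> B (v - (v.@[x])%:MP) ->
    B (u * v - ((u * v).@[x])%:MP).
  move=> hu hv; rewrite mevalM mpolyCM.
  set a := u.@[x] in hu *; set b := v.@[x] in hv *.
  have -> : u * v - a%:MP * b%:MP = v * (u - a%:MP) + a%:MP * (v - b%:MP) by ring.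
  by apply: BD; apply: BM.
have E1 : B (1 - ((1 : S).@[x])%:MP) by rewrite meval1 mpolyC1 subrr.
rewrite [q]mpolyE; apply: (big_ind (fun q : S => B (q - (q.@[x])%:MP))).
- by rewrite meval0 mpolyC0 subrr.
- by move=> u v hu hv; rewrite mevalD mpolyCD opprD addrACA; apply: BD.
move=> m _; rewrite mevalZ mpolyCM mul_mpolyC -scalerBr; apply: ideal_scale => //.
rewrite mpolyXE_id.
apply: (big_ind (fun q : S => B (q - (q.@[x])%:MP))) => // i _.
elim: (m i) => [|e IH]; first by rewrite expr0.
by rewrite exprS; apply: EM => //; rewrite mevalXU.
Qed.

Definition homog_ideal A := forall (p : S) d, A p -> A (pihomog mdeg d p).

Lemma pihomog_mulX (i : 'I_n) d (p : S) :
  pihomog mdeg d.+1 ('X_i * p) = 'X_i * pihomog mdeg d p.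
Proof.
rewrite [p]mpolyE mulr_sumr !raddf_sum mulr_sumr; apply: eq_bigr => m _ /=.
rewrite -scalerAr !linearZ /= -scalerAr; congr (_ *: _).
rewrite -mpolyXD !pihomogX /= mdegD mdeg1 add1n eqSS.
by case: ifP; rewrite ?mulr0 ?mpolyXD.
Qed.

Lemma pihomog0_mulX (i : 'I_n) (p : S) : pihomog mdeg 0 ('X_i * p) = 0.
Proof.
rewrite [p]mpolyE mulr_sumr raddf_sum big1 // => m _ /=.
by rewrite -scalerAr linearZ /= -mpolyXD pihomogX /= mdegD mdeg1 add1n scaler0.
Qed.

Lemma adjoin_homog A i : homog_ideal A -> homog_ideal (adjoin A 'X_i).
Proof.
move=> hA p [|d] [h hp].
  by exists 0; rewrite mulr0 subr0; have := hA _ 0%N hp; rewrite raddfB /= pihomog0_mulX subr0.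
by exists (pihomog mdeg d h); have := hA _ d.+1 hp; rewrite raddfB /= pihomog_mulX.
Qed.

Lemma nilpotent_monomials A (N : 'I_n -> nat) : is_ideal A ->
    (forall i, A ('X_i ^+ N i)) ->
  forall m : 'X_{1..n}, (\sum_i N i <= mdeg m)%N -> (0 < n)%N -> A 'X_[m].
Proof.
move=> [A0 AD AM] hN m hm n0.
have [i Ni] : exists i, (N i <= m i)%N.
  apply/existsP; apply: contraLR hm; rewrite negb_exists => /forallP h.
  rewrite -ltnNge mdegE; pose i0 := Ordinal n0.
  rewrite (bigD1 i0) //= [ltnRHS](bigD1 i0) //= -addSn leq_add //.
    by rewrite ltnNge.
  by apply: leq_sum => i _; apply: ltnW; rewrite ltnNge.
have -> : m = (U_(i) *+ N i + (m - U_(i) *+ N i))%MM.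
  rewrite addmC submK //; apply/mnm_lepP => j; rewrite mulmnE mnm1E.
  by case: eqP => [<-|]; rewrite ?mul1n.
by rewrite mpolyXD mulrC -mpolyXn; apply: AM.
Qed.

(** * Dehomogenization at one variable *)

Section Step.
Variables (A : S -> Prop) (t : 'I_n) (D : nat).
Hypotheses (iA : is_ideal A) (hA : homog_ideal A).
Hypothesis big : forall m : 'X_{1..n}, (D <= mdeg m)%N -> adjoin A 'X_t 'X_[m].
Local Notation Q := (adjoin A ('X_t - 1)).

(** In degree d + 1 the relation 1 + h - X_t h in A says that h_{d+1} is congruent to X_t h_d. Hence
    X_t^d + h_d lies in A for all d, and h_d = 0 for large d. *)
Lemma adjoin_one : Q 1 -> exists N, A ('X_t ^+ N).
Proof.
move=> [h]; rewrite mulrBl mul1r opprB => hh.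
have [_ AD AM] := iA.
have hd d : A ('X_t ^+ d + pihomog mdeg d h).
  elim: d => [|d IH].
    have := hA 0%N hh; rewrite !raddfD !raddfN /= pihomog0_mulX subr0 expr0.
    by rewrite pihomog_dE ?dhomog1.
  have := hA d.+1 hh; rewrite !raddfD !raddfN /= pihomog_mulX.
  rewrite (@pihomog_ne0 _ _ _ 0) ?dhomog1 // add0r => h1.
  have -> : 'X_t ^+ d.+1 + pihomog mdeg d.+1 h =
    'X_t * ('X_t ^+ d + pihomog mdeg d h) +
    (pihomog mdeg d.+1 h - 'X_t * pihomog mdeg d h) by rewrite exprS; ring.
  by apply: AD => //; apply: AM.
exists (msize h); have := hd (msize h).
suff -> : pihomog mdeg (msize h) h = 0 by rewrite addr0.
rewrite pihomogE big_seq_cond big_pred0 // => m.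
by apply/negP => /andP[/msize_mdeg_lt lt /eqP e]; rewrite /= e ltnn in lt.
Qed.

(** A monomial of degree at least D is congruent modulo A to X_t h with h homogeneous of degree one
    less, or to 0 in degree 0. As X_t is 1 modulo Q, the degree drops. *)
Lemma adjoin_reduce (p : S) : exists2 p', (msize p' <= D)%N & Q (p - p').
Proof.
have iQ : is_ideal Q by apply: adjoin_ideal.
have [Q0 QD QM] := iQ.
elim: {p}(msize p) {-2}p (leqnn (msize p)) => [|d IH] p hp.
  by exists p; rewrite ?subrr // (leq_trans hp).
have [le|lt] := leqP d.+1 D; first by exists p; rewrite ?subrr // (leq_trans hp).
suff [p1 h1 Q1] : exists2 p1, (msize p1 <= d)%N & Q (p - p1).
  have [p' h' Q'] := IH _ h1; exists p' => //.
  by rewrite -[p](subrK p1) -addrA; apply: QD.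
rewrite [p]mpolyE big_seq.
apply: (big_ind (fun u : S => exists2 p1, (msize p1 <= d)%N & Q (u - p1))).
- by exists 0; rewrite ?subrr // msize0.
- move=> u v [u' hu Qu] [v' hv Qv]; exists (u' + v').
    by rewrite (leq_trans (msizeD_le _ _)) // geq_max hu.
  by rewrite opprD addrACA; apply: QD.
move=> m /msize_mdeg_lt /leq_trans /(_ hp); rewrite ltnS leq_eqVlt.
have sc (u v : S) : (msize v <= d)%N -> Q (u - v) ->
    exists2 p1, (msize p1 <= d)%N & Q (p@_m *: u - p1).
  move=> hv Qu; exists (p@_m *: v); first exact: leq_trans (msizeZ_le _ _) hv.
  by rewrite -scalerBr; apply: ideal_scale.
case/orP=> [/eqP md|lt']; last first.
  by apply: (sc _ 'X_[m]); rewrite ?subrr // msizeX.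
have [|h hh] := big (m := m); first by rewrite md.
case: d {IH hp sc} lt md sc => [|d] lt md sc.
  have m0 : m = 0%MM by apply/eqP; rewrite -mdeg_eq0 md.
  apply: (sc _ 0); rewrite ?msize0 // subr0.
  have := hA 0%N hh; rewrite raddfB /= pihomog0_mulX subr0 pihomogX /= md eqxx.
  exact: sub_adjoin.
apply: (sc _ (pihomog mdeg d h)).
  rewrite pihomogE; apply: (leq_trans (msize_sum _ _ _)).
  apply/bigmax_leqP_seq => a _ /eqP ad.
  by rewrite (leq_trans (msizeZ_le _ _)) // msizeX -ad.
have := hA d.+1 hh; rewrite raddfB /= pihomog_mulX pihomogX /= md eqxx => h1.
exists (pihomog mdeg d h).
by have -> : 'X_[m] - pihomog mdeg d h - ('X_t - 1) * pihomog mdeg d h =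
   'X_[m] - 'X_t * pihomog mdeg d h by ring.
Qed.

(** The first M + 1 powers of z reduce to polynomials supported on M monomials; a linear relation
    among these reductions is an equation for z. *)
Lemma adjoin_algebraic (z : S) : algebraic_mod Q z.
Proof.
have iQ : is_ideal Q by apply: adjoin_ideal.
pose M := #|{: 'X_{1..n < D}}|.
have [F hF hQ] : exists2 F : 'I_M.+1 -> S, forall i, (msize (F i) <= D)%N &
    forall i : 'I_M.+1, Q (z ^+ i - F i).
  exact: (fin_all_exists2 (fun i : 'I_M.+1 => adjoin_reduce (z ^+ i))).

pose C : 'M[k]_(M.+1, M) := \matrix_(i, j) (F i)@_(val (enum_val j)).
have : kermx C != 0.
  rewrite kermx_eq0 /row_free neq_ltn.
  by rewrite (leq_ltn_trans (rank_leq_col C)).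
case/rowV0Pn => u /sub_kermxP uC u0.
have F0 : \sum_i u 0 i *: F i = 0.
  apply/mpolyP => m; rewrite mcoeff0 raddf_sum /=.
  have [mD|mD] := ltnP (mdeg m) D; last first.
    rewrite big1 // => i _; rewrite mcoeffZ memN_msupp_eq0 ?mulr0 //.
    by apply: msize_mdeg_ge; apply: leq_trans mD.
  have /rowP/(_ (enum_rank (BMultinom mD))) := uC; rewrite !mxE => e.
  rewrite -[RHS]e; apply: eq_bigr => i _.
  by rewrite mcoeffZ mxE enum_rankK.
pose f := \poly_(i < M.+1) u 0 (inord i).
have fE (i : 'I_M.+1) : f`_i = u 0 i by rewrite coef_poly ltn_ord inord_val.
exists f.
  apply: contraNneq u0 => f0; apply/eqP/rowP => i.
  by rewrite mxE -fE f0 coef0.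
have -> : \sum_(i < size f) f`_i *: z ^+ i = \sum_(i < M.+1) f`_i *: z ^+ i.
  rewrite (big_ord_widen M.+1 (fun i => f`_i *: z ^+ i)) ?size_poly //.
  rewrite big_mkcond; apply: eq_bigr => i _; case: ltnP => // le.
  by rewrite nth_default // scale0r.
have -> : \sum_(i < M.+1) f`_i *: z ^+ i =
          \sum_(i < M.+1) (f`_i *: z ^+ i - u 0 i *: F i).
  by rewrite sumrB F0 subr0.
apply: ideal_sum => // i _.
by rewrite fE -scalerBr; apply: ideal_scale.
Qed.

End Step.

(** Induction on the number t of variables not known to lie in A. All variables are nilpotent modulo
    A + (X_t). If no power of X_t were in A, then A + (X_t - 1) would be proper and have a zero; as
    a zero of A it is the origin, contradicting X_t = 1. *)
Lemma homog_nilpotent A : is_ideal A -> homog_ideal A ->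
    (forall x : 'I_n -> k, (forall p, A p -> p.@[x] = 0) -> forall i, x i = 0) ->
  forall i, exists N, A ('X_i ^+ N).
Proof.
move=> iA0 hA0 vA0.
suff H t A' : is_ideal A' -> homog_ideal A' ->
    (forall x : 'I_n -> k, (forall p, A' p -> p.@[x] = 0) -> forall i, x i = 0) ->
    (forall i : 'I_n, (t <= i)%N -> A' 'X_i) -> forall i, exists N, A' ('X_i ^+ N).
  by apply: (H n) => // i; rewrite leqNgt ltn_ord.
elim: t {A iA0 hA0 vA0} A' => [|t IH] A iA hA vA.
  by move=> h i; exists 1%N; apply: h.
have [tn|nt] := ltnP t n; last first.
  move=> _; apply: IH => // i ti.
  by have := ltn_ord i; rewrite ltnNge (leq_trans nt).
pose ot := Ordinal tn => hX.
have iA' : is_ideal (adjoin A 'X_ot) by apply: adjoin_ideal.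
have vA' (x : 'I_n -> k) : (forall p, adjoin A 'X_ot p -> p.@[x] = 0) ->
    forall i, x i = 0.
  by move=> hx; apply: vA => p Ap; apply/hx/sub_adjoin.
have hX' (i : 'I_n) : (t <= i)%N -> adjoin A 'X_ot 'X_i.
  rewrite leq_eqVlt => /orP[/eqP e|ti]; last exact/sub_adjoin/hX.
  have -> : i = ot by apply: val_inj.
  exact: mem_adjoin.
have [N hN] := fin_all_exists (IH _ iA' (adjoin_homog hA) vA' hX').
have big m := nilpotent_monomials iA' hN (m := m) ^~ (leq_ltn_trans (leq0n _) tn).
have [_ AD AM] := iA.
have [Nt hNt] : exists Nt, A ('X_ot ^+ Nt).
  apply: NNPP => no.
  have Q1 : ~ adjoin A ('X_ot - 1) 1 by move/(adjoin_one iA hA).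
  have [x hx] := proper_zero (adjoin_ideal _ iA) Q1
    (fun i => adjoin_algebraic iA hA big 'X_i).
  have x0 : x ot = 0 by apply: vA => p Ap; apply/hx/sub_adjoin.
  have := hx _ (mem_adjoin _ iA); rewrite mevalB mevalXU meval1 x0 => /eqP.
  by rewrite sub0r oppr_eq0 oner_eq0.
move=> i; have [h hh] := hN i; exists (N i * Nt)%N.
rewrite exprM -[_ ^+ Nt](subrK (('X_ot * h) ^+ Nt)) subrXX exprMn [_ ^+ Nt * _]mulrC.
by apply: AD; [rewrite mulrC; apply: AM | apply: AM].
Qed.

Lemma pihomog_mulr d e (p g : S) : g \is e.-homog ->
  pihomog mdeg d (p * g) = if (e <= d)%N then pihomog mdeg (d - e) p * g else 0.
Proof.
move=> hg; rewrite [p]mpolyE mulr_suml !raddf_sum /= mulr_suml.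
transitivity (\sum_(m <- msupp p) if (e <= d)%N then
    pihomog mdeg (d - e) (p@_m *: 'X_[m]) * g else 0); last first.
  by case: ifP => // _; rewrite big1.
apply: eq_bigr => m _; rewrite -scalerAl linearZ /=.
have hm : 'X_[m] * g \is (mdeg m + e).-homog by rewrite dhomogM // dhomogX.
have [e1|ne] := eqVneq (mdeg m + e)%N d.
  rewrite -e1 pihomog_dE // leq_addl addnK linearZ /= pihomogX eqxx.
  by rewrite scalerAl.
rewrite (pihomog_ne0 ne hm) scaler0; case: ifP => // led.
rewrite linearZ /= pihomogX ifN ?scaler0 ?mul0r //.
by apply: contraNneq ne => /= ->; rewrite subnK.
Qed.

Theorem homog_nullstellensatz (I : finType) (G : I -> S) (e : I -> nat) :
    (forall i, G i \is (e i).-homog) ->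
    (forall x : 'I_n -> k, (forall i, (G i).@[x] = 0) -> forall j, x j = 0) ->
  exists N, forall j, exists c : I -> S, 'X_j ^+ N = \sum_i c i * G i.
Proof.
move=> hG vG; pose A p := exists c : I -> S, p = \sum_i c i * G i.
have iA : is_ideal A.
  split=> [|p u [c ->] [c' ->]|p u [c ->]].
  - by exists (fun=> 0); rewrite big1 // => i _; rewrite mul0r.
  - exists (fun i => c i + c' i); rewrite -big_split; apply: eq_bigr => i _.
    by rewrite mulrDl.
  - by exists (fun i => p * c i); rewrite mulr_sumr; apply: eq_bigr => i _; rewrite mulrA.
have hA : homog_ideal A.
  move=> p d [c ->]; rewrite raddf_sum /=.
  exists (fun i => if (e i <= d)%N then pihomog mdeg (d - e i) (c i) else 0).
  apply: eq_bigr => i _; rewrite (pihomog_mulr _ _ (hG i)).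
  by case: ifP; rewrite ?mul0r.
have vA (x : 'I_n -> k) : (forall p, A p -> p.@[x] = 0) -> forall i, x i = 0.
  move=> hx; apply: vG => i; apply: hx; exists (fun j => (j == i)%:R).
  rewrite (bigD1 i) //= eqxx mul1r big1 ?addr0 // => j /negbTE ->.
  by rewrite mul0r.
have [N hN] := fin_all_exists (homog_nilpotent iA hA vA).
have [_ _ AM] := iA; exists (\sum_i N i)%N => j.
suff : A ('X_j ^+ (\sum_i N i)) by [].
by rewrite (bigD1 j) //= addnC exprD; apply: AM.
Qed.

End Nullstellensatz.

(** * Determinants bordering a syzygy *)

(** Unit rows are independent modulo the row space of [A] when the corresponding rows of its
    cokernel matrix are independent; [g] selects a maximal such family. *)
Lemma complete_rows (F : fieldType) m t r (A : 'M[F]_(m, r)) :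
    row_free A -> r = (m + t)%N ->
  exists g : 'I_t -> 'I_r, row_free (col_mx A (rowsub g 1%:M)).
Proof.
move=> fA er.
have rk : \rank (cokermx A) = t.
  by rewrite mxrank_coker (eqP fA) er addKn.
have [g] : exists g : 'I_(\rank (cokermx A)) -> 'I_r,
    row_free (rowsub g (cokermx A)).
  by eexists; apply: maxrowsub_free.
rewrite rk in g * => fg; exists g; apply: inj_row_free => v.
rewrite -[v]hsubmxK mul_row_col => e.
have r0 : rsubmx v = 0.
  apply: (row_free_inj fg); rewrite mul0mx -[RHS](mul0mx _ (cokermx A)) -e.
  rewrite mulmxDl -!mulmxA mulmx_coker mulmx0 add0r.
  by rewrite mul_rowsub_mx mul1mx.
move: e; rewrite r0 mul0mx addr0 => e.
have -> : lsubmx v = 0 by apply: (row_free_inj fA); rewrite mul0mx.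
by rewrite row_mx0.
Qed.

Lemma row_free_colC (F : fieldType) m t r (A : 'M[F]_(m, r)) (B : 'M_(t, r)) :
  row_free (col_mx A B) = row_free (col_mx B A).
Proof. by rewrite /row_free -!addsmxE addsmxC addnC. Qed.

Lemma row_free_colCA (F : fieldType) m t u r (A : 'M[F]_(m, r)) (B : 'M_(t, r))
    (C : 'M_(u, r)) :
  row_free (col_mx (col_mx A B) C) = row_free (col_mx (col_mx A C) B).
Proof.
have e m1 m2 m3 (X : 'M[F]_(m1, r)) (Y : 'M_(m2, r)) (D : 'M_(m3, r)) :
     \rank (col_mx (col_mx X Y) D) = \rank (X + Y + D)%MS.
  by rewrite -addsmxE (adds_eqmx (eqmx_sym (addsmxE X Y)) (eqmx_refl D)).
by rewrite /row_free !e -!addsmxA [(B + C)%MS]addsmxC addnAC.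
Qed.

Lemma minorE (S : comNzRingType) r p (T : 'M[S]_(r, 1 + p)) f (l : 'I_(1 + p)) :
  minor T f l = (-1) ^+ l * \det (rowsub f (col' l T)).
Proof.
rewrite -(cofactor_minor T f l) /cofactor add0n; congr (_ * \det _).
apply/matrixP => i j; rewrite !mxE.
case: splitP => [[[|//] ?] //|a /= e].
rewrite !mxE; congr (T (f _) _); apply: val_inj; move: e => /=; rewrite /bump /=.
by case.
Qed.

Section Theta.
Variables (S : comNzRingType) (q p : nat) (om : 'rV[S]_(1 + q + p)).
Local Notation r := (1 + q + p)%N.
Implicit Types (f : 'I_p -> 'I_r) (ws : seq 'rV[S]_r).

Definition theta_mx f ws : 'M[S]_r :=
  col_mx (col_mx om (\matrix_(i < q) nth 0 ws i)) (rowsub f 1%:M).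

Definition theta f ws := \det (theta_mx f ws).

Definition slot (i : 'I_q) : 'I_r := lshift p (rshift 1 i).

Lemma row_slot f ws i : row (slot i) (theta_mx f ws) = nth 0 ws i.
Proof. by rewrite /theta_mx rowKu rowKd rowK. Qed.

Lemma row_theta_eq f ws ws' k : (forall i, k = slot i -> nth 0 ws i = nth 0 ws' i) ->
  row k (theta_mx f ws) = row k (theta_mx f ws').
Proof.
move=> h; rewrite /theta_mx.
case: (split_ordP k) h => [a ->|a -> _]; last by rewrite !rowKd.
case: (split_ordP a) => [b -> _|b -> h]; first by rewrite !rowKu.
by rewrite !rowKu !rowKd !rowK h.
Qed.

Lemma slot_inj : injective slot.
Proof. by move=> i j /lshift_inj/rshift_inj. Qed.

Lemma theta_lin f w1 w2 (c : S) u v : size (w1 ++ u :: w2) = q ->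
  theta f (w1 ++ (c *: u + v) :: w2) =
  c * theta f (w1 ++ u :: w2) + theta f (w1 ++ v :: w2).
Proof.
rewrite size_cat /= addnS => sq; have i0q : (size w1 < q)%N.
  by apply: leq_trans (leq_addr (size w2) _) _; rewrite addSn sq.
pose i0 := Ordinal i0q; rewrite -[theta f (_ ++ v :: _)]mul1r.
have hr x : row (slot i0) (theta_mx f (w1 ++ x :: w2)) = x.
  by rewrite row_slot nth_cat ltnn subnn.
have hr' x y : row' (slot i0) (theta_mx f (w1 ++ x :: w2)) =
               row' (slot i0) (theta_mx f (w1 ++ y :: w2)).
  apply/row_matrixP => k; rewrite !row_rowsub; apply: row_theta_eq => i ei.
  have ne : (i : nat) != size w1.
    apply: contra_eq_neq ei => e; have -> : i = i0 by apply: val_inj.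
    by rewrite eq_sym neq_lift.
  rewrite !nth_cat; case: ltnP => // le.
  by move: ne; case: (i - size w1)%N (subnKC le) => [|//]; rewrite addn0 => ->; rewrite eqxx.
by apply: (determinant_multilinear (i0 := slot i0)); rewrite ?scale1r ?hr.
Qed.

Lemma theta_sum f w1 w2 (I : Type) (s : seq I) (c : I -> S) u :
    (size w1 + (size w2).+1 = q)%N ->
  theta f (w1 ++ (\sum_(b <- s) c b *: u b) :: w2) =
  \sum_(b <- s) c b * theta f (w1 ++ u b :: w2).
Proof.
move=> sq; have sz x : size (w1 ++ x :: w2) = q by rewrite size_cat.
elim: s => [|b s IH]; last by rewrite !big_cons theta_lin ?IH.
rewrite !big_nil; have := @theta_lin f w1 w2 (-1) 0 0 (sz 0).
by rewrite scaler0 addr0 mulN1r addNr.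
Qed.

Lemma theta_swap f w1 w2 u v : size (w1 ++ u :: v :: w2) = q ->
  theta f (w1 ++ u :: v :: w2) = - theta f (w1 ++ v :: u :: w2).
Proof.
move=> sq; have sz x y : size (w1 ++ x :: y :: w2) = q by apply: etrans sq; rewrite !size_cat.
have alt x : theta f (w1 ++ x :: x :: w2) = 0.
  have := sz x x; rewrite size_cat /= => szx.
  have h1 : (size w1 < q)%N by lia.
  have h2 : ((size w1).+1 < q)%N by lia.
  apply: (@determinant_alternate _ _ _ (slot (Ordinal h1)) (slot (Ordinal h2))).
    by apply/eqP => /slot_inj [] /eqP; rewrite ltn_eqF.
  move=> j; have e k : theta_mx f (w1 ++ [:: x, x & w2]) k j =
    row k (theta_mx f (w1 ++ [:: x, x & w2])) 0 j by rewrite [RHS]mxE.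
  by rewrite !e !row_slot !nth_cat /= ltnn subnn ltnNge leqnSn /= subSnn.
have linL x y z : theta f (w1 ++ (x + y) :: z :: w2) =
    theta f (w1 ++ x :: z :: w2) + theta f (w1 ++ y :: z :: w2).
  by rewrite -[x]scale1r theta_lin ?mul1r ?scale1r.
have linR x y z : theta f (w1 ++ z :: (x + y) :: w2) =
    theta f (w1 ++ z :: x :: w2) + theta f (w1 ++ z :: y :: w2).
  have e t : w1 ++ z :: t :: w2 = (w1 ++ [:: z]) ++ t :: w2 by rewrite -catA.
  by rewrite -[x]scale1r !e theta_lin -?e ?mul1r ?scale1r.
have := alt (u + v); rewrite linL !linR !alt add0r addr0 => /eqP.
by rewrite addr_eq0 => /eqP.
Qed.

(** The value 0 on lists of other lengths makes skewness hold on all lists. *)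
Definition theta_form f (s : seq 'I_r) : S :=
  if size s == q then theta f (map (delta_mx 0) s) else 0.

Lemma theta_form_skew f s1 a b s2 :
  theta_form f (s1 ++ a :: b :: s2) = - theta_form f (s1 ++ b :: a :: s2).
Proof.
rewrite /theta_form; have -> : size (s1 ++ b :: a :: s2) = size (s1 ++ a :: b :: s2).
  by rewrite !size_cat.
case: eqP => sq; last by rewrite oppr0.
rewrite !map_cat /= theta_swap //.
by apply: etrans sq; rewrite !size_cat /= !size_map.
Qed.

Lemma mlin_theta n f ws : size ws = q ->
  mlin (fun s => (theta_form f s)%:MP : {mpoly S[n]}) ws = (theta f ws)%:MP.
Proof.
move=> sq.
suff H pre : (size pre + size ws = q)%N ->
    mlin (fun s => (if size s == size ws then theta f (pre ++ map (delta_mx 0) s)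
                    else 0)%:MP : {mpoly S[n]}) ws = (theta f (pre ++ ws))%:MP.
  rewrite -[RHS](H [::]) //; apply: mlin_ext => s ss.
  by rewrite /theta_form sq.
elim: ws pre {sq} => [|w ws IH] pre /= sq; first by [].
rewrite {2}[w]row_sum_delta theta_sum // rmorph_sum; apply: eq_bigr => a _.
rewrite rmorphM /= mul_mpolyC; congr (_ *: _).
have e (v : 'rV[S]_r) t : pre ++ v :: t = (pre ++ [:: v]) ++ t by rewrite -catA.
rewrite e -IH; last by rewrite size_cat /= addn1 addSnnS.
by apply: mlin_ext => s _ /=; rewrite eqSS -catA.
Qed.

(** The vectors subtracted are combinations of the unit rows at the bottom of the determinant, so
    row operations, encoded in the triangular matrix [U], remove them; q factors [d] remain. *)
Lemma theta_scale f (Z : 'M[S]_(r, p)) (d : S) (s : seq 'I_r) : size s = q ->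
  theta f [seq d *: delta_mx 0 a - row a (Z *m rowsub f 1%:M) | a <- s] =
  d ^+ q * theta_form f s.
Proof.
move=> sq; rewrite /theta_form sq eqxx /theta.
pose Y : 'M[S]_(q, p) := \matrix_(i < q) row (nth (slot i) s i) Z.
pose U : 'M[S]_r := block_mx (block_mx (1%:M : 'M_1) 0 0 (d%:M : 'M_q))
                             (col_mx 0 (- Y)) 0 1%:M.
have detU : \det U = d ^+ q by rewrite !det_ublock !det1 mul1r mulr1 det_scalar.
rewrite -detU -det_mulmx; congr (\det _).
rewrite /U /theta_mx mul_block_col mul_block_col !mul1mx !mul0mx addr0 add0r.
rewrite mul_col_mx mul0mx add_col_mx addr0 add0r; congr (col_mx (col_mx _ _) _).
apply/row_matrixP => i; rewrite rowK linearD /= !row_mul.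
rewrite (nth_map (slot i)) ?sq // -row_mul mul_scalar_mx linearZ /= rowK.
by rewrite (nth_map (slot i)) ?sq // linearN /= rowK mulNmx -row_mul.
Qed.

Lemma theta_mx_map (S' : comNzRingType) (g : {rmorphism S -> S'}) f (s : seq 'I_r) :
  size s = q ->
  map_mx g (theta_mx f (map (delta_mx 0) s)) =
  col_mx (col_mx (map_mx g om) (\matrix_(i < q) delta_mx 0 (nth (slot i) s i)))
         (rowsub f 1%:M).
Proof.
move=> sq; rewrite /theta_mx !map_col_mx; congr (col_mx (col_mx _ _) _).
  apply/row_matrixP => i; rewrite -map_row !rowK (nth_map (slot i)) ?sq //.
  exact: map_delta_mx.
by rewrite map_mxsub map_mx1.
Qed.

End Theta.

(** Proportionality of complementary minors. Unless both minors of [T] vanish, unit columns [X]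
    complete [T] to an invertible matrix. Multiplying it by the bordered [W] gives a block
    triangular matrix whose blocks are W X, independent of the rows chosen, and the minor of [T]. *)
Lemma det_exchange_field (F : fieldType) s p (W : 'M[F]_(s, s + p))
    (T : 'M[F]_(s + p, p)) f f' : W *m T = 0 ->
  \det (rowsub f' T) * \det (col_mx W (rowsub f 1%:M)) =
  \det (rowsub f T) * \det (col_mx W (rowsub f' 1%:M)).
Proof.
move=> WT; wlog nz : f f' / \det (rowsub f T) != 0.
  move=> H; have [e|] := eqVneq (\det (rowsub f T)) 0; last exact: H.
  have [->|/H ->//] := eqVneq (\det (rowsub f' T)) 0; first by rewrite e !mul0r.
have fT : row_free T^T.
  apply: inj_row_free => v /(congr1 trmx); rewrite trmx_mul trmxK trmx0 => e.
  have u : rowsub f T \in unitmx by rewrite unitmxE unitfE.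
  apply: trmx_inj; rewrite trmx0 -[LHS](mulKmx u) mul_rowsub_mx e.
  by rewrite (_ : rowsub f 0 = 0) ?mulmx0 //; apply/matrixP => i j; rewrite !mxE.
have [g fg] := complete_rows fT (addnC s p).
pose X : 'M[F]_(s + p, s) := (rowsub g 1%:M)^T.
have XT : \det (row_mx X T) != 0.
  rewrite -unitfE -unitmxE -unitmx_tr tr_row_mx trmxK -row_free_unit.
  by rewrite row_free_colC.
have key h : \det (col_mx W (rowsub h 1%:M)) * \det (row_mx X T) =
             \det (W *m X) * \det (rowsub h T).
  by rewrite -det_mulmx mul_col_row WT det_lblock mul_rowsub_mx mul1mx.
by apply: (mulIf XT); rewrite -!mulrA !key mulrCA mulrA mulrC mulrA.
Qed.

Lemma det_exchange (S : idomainType) s p (W : 'M[S]_(s, s + p))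
    (T : 'M[S]_(s + p, p)) f f' : W *m T = 0 ->
  \det (rowsub f' T) * \det (col_mx W (rowsub f 1%:M)) =
  \det (rowsub f T) * \det (col_mx W (rowsub f' 1%:M)).
Proof.
move=> WT; apply/eqP; rewrite -tofrac_eq; apply/eqP.
rewrite !rmorphM /= -!det_map_mx !map_col_mx !map_mxsub !map_mx1.
by apply: det_exchange_field; rewrite -map_mxM WT map_mx0.
Qed.

Section ThetaKernel.
Variables (S : idomainType) (q p : nat) (om : 'rV[S]_(1 + q + p)).
Local Notation r := (1 + q + p)%N.
Variable T : 'M[S]_(r, 1 + p).
Hypothesis omT : om *m T = 0.

(* [theta om f ws / minor T f l] does not depend on [f] when [ws] is in the kernel of
   [T]: this is what allows to patch the forms of the various charts. *)
Lemma theta_minor f f' l (ws : seq 'rV[S]_r) : {in ws, forall w, w *m T = 0} ->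
  minor T f' l * theta om f ws = minor T f l * theta om f' ws.
Proof.
move=> wT; rewrite !minorE -!mulrA; congr (_ * _); apply: det_exchange.
have colT m (B : 'M[S]_(m, r)) : B *m T = 0 -> B *m col' l T = 0.
  by move=> BT; rewrite mulmx_colsub BT; apply/matrixP => i j; rewrite !mxE.
apply: colT; rewrite mul_col_mx omT; apply/row_matrixP => i.
rewrite row0; case: (split_ordP i) => a ->; first by rewrite rowKu row0.
rewrite rowKd row_mul rowK.
have [aw|aw] := ltnP a (size ws); first by rewrite wT ?mem_nth.
by rewrite nth_default // mul0mx.
Qed.

(** Over the fraction field, suppose [om] is nonzero. It is killed by [T], while the rows [f] of [T]
    are independent, so [om] and the unit rows [f] are independent. Completing them by q unit rows
    yields a nonzero value of the form. *)
Lemma theta_form_eq0 f l : minor T f l != 0 ->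
  (forall s, size s = q -> theta_form om f s = 0) -> om = 0.
Proof.
move=> nz h; pose toF : {rmorphism S -> {fraction S}} := @FracField.tofrac S.
apply/eqP; apply: contraT => om0.
pose omF := map_mx toF om; pose TF := map_mx toF T.
have TfF : row_free (rowsub f TF).
  have u : minor_mx TF f l \in unitmx.
    rewrite unitmxE unitfE -/(minor TF f l).
    have -> : minor TF f l = toF (minor T f l).
      by rewrite !minorE rmorphM /= rmorph_sign -det_map_mx !map_mxsub.
    by rewrite tofrac_eq0.
  apply: inj_row_free => v e; have : row_mx 0 v *m minor_mx TF f l = 0.
    by rewrite mul_row_col mul0mx add0r.
  move/(congr1 (mulmx^~ (invmx (minor_mx TF f l)))); rewrite /= mulmxK // mul0mx.
  by move/(congr1 (@rsubmx _ 1 1 p)); rewrite row_mxKr => ->; rewrite linear0.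
have omF0 : omF != 0.
  apply: contra_neq om0 => e; apply/rowP => j; have /rowP/(_ j)/eqP := e.
  by rewrite !mxE tofrac_eq0 => /eqP.
have fA : row_free (col_mx omF (rowsub f 1%:M)).
  apply: inj_row_free => v; rewrite -[v](@hsubmxK _ 1 1 p) mul_row_col => e.
  have v0 : rsubmx v = 0 :> 'rV_p.
    apply: (row_free_inj TfF); rewrite mul0mx -[RHS](mul0mx _ TF) -e mulmxDl.
    by rewrite -!mulmxA -map_mxM omT map_mx0 mulmx0 add0r mul_rowsub_mx mul1mx.
  move: e; rewrite v0 mul0mx addr0 [lsubmx v]mx11_scalar mul_scalar_mx => /eqP.
  rewrite scaler_eq0 (negbTE omF0) orbF => /eqP ->.
  by rewrite (raddf0 (@scalar_mx _ 1)) row_mx0.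
have [g fg] := complete_rows fA (addnAC 1 q p).
have := h [seq g i | i <- enum 'I_q]; rewrite size_map size_enum_ord => /(_ erefl).
set s := map _ _; have ss : size s = q by rewrite size_map size_enum_ord.
rewrite /theta_form ss eqxx => /(congr1 toF); rewrite rmorph0 -det_map_mx.
rewrite theta_mx_map // => /eqP; apply: contraTT => _.
rewrite -unitfE -unitmxE -row_free_unit.
have -> : \matrix_(i < q) delta_mx 0 (nth (slot p i) s i) = rowsub g 1%:M
    :> 'M[{fraction S}]_(q, r).
  apply/row_matrixP => i; rewrite rowK row_rowsub row1.
  by rewrite (nth_map i) ?size_enum_ord // nth_ord_enum.
by rewrite row_free_colCA.
Qed.

End ThetaKernel.

(** * Vanishing of syzygies *)

Section Degrees.
Variables (k : idomainType) (n : nat).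
Local Notation S := {mpoly k[n]}.

Lemma homog_prod (I : finType) (e : I -> nat) (F : I -> S) :
  (forall i, F i \is (e i).-homog) -> \prod_i F i \is (\sum_i e i).-homog.
Proof.
move=> h; elim/big_rec2: _ => [|i p d _ hp]; first exact: dhomog1.
exact: dhomogM.
Qed.

Lemma homog_det m (M : 'M[S]_m) (e : 'I_m -> nat) :
  (forall i j, M i j \is (e i).-homog) -> \det M \is (\sum_i e i).-homog.
Proof.
move=> h; apply: rpred_sum => s _.
by rewrite rpredMsign; apply: homog_prod.
Qed.

Lemma homog_cofactor m (M : 'M[S]_m.+1) (e : 'I_m.+1 -> nat) i j :
  (forall i j, M i j \is (e i).-homog) ->
  cofactor M i j \is (\sum_i e i - e i).-homog.
Proof.
move=> h; rewrite /cofactor rpredMsign (bigD1_ord i) //= addKn.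
by apply: homog_det => a b; rewrite !mxE.
Qed.

(* [u] lies in the [i]-th power of the irrelevant ideal. *)
Definition ord_ge i (u : S) := forall m, m \in msupp u -> (i <= mdeg m)%N.

Lemma ord_ge0 i : ord_ge i 0.
Proof. by move=> m; rewrite msupp0. Qed.

Lemma ord_geD i u v : ord_ge i u -> ord_ge i v -> ord_ge i (u + v).
Proof. by move=> hu hv m /msuppD_le; rewrite mem_cat => /orP[/hu|/hv]. Qed.

Lemma ord_geM i j u v : ord_ge i u -> ord_ge j v -> ord_ge (i + j) (u * v).
Proof.
move=> hu hv m /msuppM_le/allpairsP[[a b] /= [/hu ha /hv hb ->]].
by rewrite mdegD leq_add.
Qed.

Lemma ord_ge_homog i u : u \is i.-homog -> ord_ge i u.
Proof. by move=> /dhomogP h m /h /= ->. Qed.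

Lemma homog_ord_eq0 i j u : (i < j)%N -> u \is i.-homog -> ord_ge j u -> u = 0.
Proof.
move=> ij /dhomogP h hu; apply/eqP; rewrite -msupp_eq0; case e: (msupp u) => [//|m l].
have mu : m \in msupp u by rewrite e mem_head.
by have := hu m mu; rewrite (h m mu) leqNgt ij.
Qed.

Variables (r p : nat) (T : 'M[S]_(r, 1 + p)).
Hypothesis T_homog : forall a i, T a i \is 1.-homog.

Let e (i : 'I_(1 + p)) : nat := if split i is inl _ then 0 else 1.

Let e_sum : (\sum_i e i = p)%N.
Proof.
rewrite big_split_ord /= big_ord1 /e; have -> := @unsplitK 1 p (inl 0).
rewrite add0n -[RHS]card_ord -sum1_card; apply: eq_bigr => i _.
by have -> := @unsplitK 1 p (inr i).
Qed.

Let minor_mx_homog f l i j : minor_mx T f l i j \is (e i).-homog.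
Proof.
rewrite /e /minor_mx mxE; case: splitP => a _; rewrite mxE; last exact: T_homog.
by case: (_ && _); rewrite ?dhomog1 ?dhomog0.
Qed.

Lemma minor_homog f l : minor T f l \is p.-homog.
Proof. by have := homog_det (@minor_mx_homog f l); rewrite e_sum. Qed.

Lemma minor_adj_homog f l i b : minor_adj T f l i b \is p.-1.-homog.
Proof.
rewrite /minor_adj !mxE -subn1; have := homog_cofactor (rshift 1 b) i (@minor_mx_homog f l).
by rewrite e_sum /e; have -> := @unsplitK 1 p (inr b).
Qed.

End Degrees.

Lemma theta_form_homog (k : idomainType) n q p (om : 'rV[{mpoly k[n]}]_(1 + q + p)) d f s :
  (forall j, om 0 j \is d.-homog) -> theta_form om f s \is d.-homog.
Proof.
move=> h; rewrite /theta_form; case: eqP => sq; last exact: rpred0.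
pose e (i : 'I_(1 + q + p)) : nat :=
  if split i is inl a then if split a is inl _ then d else 0 else 0.
have -> : d = (\sum_i e i)%N.
  rewrite !big_split_ord /= big_ord1 /e.
  have -> := @unsplitK (1 + q) p (inl (lshift q 0)).
  have -> := @unsplitK 1 q (inl 0).
  rewrite [X in (_ + X + _)%N]big1 => [|i _]; last first.
    have -> := @unsplitK (1 + q) p (inl (rshift 1 i)).
    by have -> := @unsplitK 1 q (inr i).
  rewrite big1 ?addn0 // => i _.
  by have -> := @unsplitK (1 + q) p (inr i).
have hb (b : bool) : (b%:R : {mpoly k[n]}) \is 0.-homog.
  by case: b; rewrite ?dhomog1 ?dhomog0.
apply: homog_det => i j; rewrite /e /theta_mx mxE; case: splitP => a _.
  rewrite mxE; case: splitP => b _; first by rewrite ord1.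
  by rewrite mxE (nth_map (slot p b)) ?sq // mxE.
by rewrite !mxE.
Qed.

Section Eigen.
Variables (S : comNzRingType) (n r : nat) (T : 'M[S]_(r, n)).

(** For w T = 0 the derivation \sum_a w_a D_a is zero. *)
Lemma mlin_cobd_ker psi (ws : seq 'rV[S]_r) :
  {in ws, forall w, w *m T = 0} -> mlin (cobd T psi) ws = 0.
Proof.
elim: ws psi => [//|w ws IH] psi wT /=.
have wsT : {in ws, forall w, w *m T = 0}.
  by move=> v vw; apply: wT; rewrite inE vw orbT.
under eq_bigr => a _.
  rewrite -(mlin_ext (psi := fun t => (-1) *: cobd T (fun v => psi (a :: v)) t +
    vfield T a (psi t))); last by move=> t _; rewrite scaleN1r addrC.
  rewrite mlinP IH // scaler0 add0r; over.
rewrite -(mlin_sum _ (fun a => w 0 a) (fun a t => vfield T a (psi t))) -[RHS](mlin0 n ws).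
apply: mlin_ext => t _; rewrite /vfield.
under eq_bigr do rewrite scaler_sumr.
rewrite exchange_big big1 //= => i _.
under eq_bigr do rewrite scalerA.
rewrite -scaler_suml; have /rowP/(_ i) := wT w (mem_head _ _).
by rewrite !mxE => ->; rewrite scale0r.
Qed.

End Eigen.

(** * Patching the charts: a syzygy of degree q vanishes *)

Section Syzygy.
Variables (k : closedFieldType) (q : nat).
Local Notation p := q.+2.
Local Notation r := (1 + q + p)%N.
Local Notation S := {mpoly k[p.+1]}.
Local Notation xv := (\col_i 'X_i : 'cV[S]_(1 + p)).
Variable T : 'M[S]_(r, 1 + p).
Hypothesis T_homog : forall a i, T a i \is 1.-homog.
Hypothesis Txv : T *m xv = 0.
Hypothesis T_ker : forall (x : 'I_(1 + p) -> k) (y : 'cV[k]_(1 + p)),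
  (exists i, x i != 0) -> map_mx (meval x) T *m y = 0 ->
  exists c, forall i, y i 0 = c * x i.
Hypothesis char_q : forall i, (0 < i <= q)%N -> i%:R != 0 :> k.
Implicit Types (f : 'I_p -> 'I_r) (l : 'I_(1 + p)).

Local Notation d f l := ('X_l * minor T f l).

Let X_homog l : 'X_l \is [in k[p.+1], 1.-homog].
Proof. by rewrite dhomogX; apply/eqP/mdeg1. Qed.

(** If x_j is nonzero, a kernel vector of T(x) with j-th coordinate 0 is 0. So T(x) without column j
    has full column rank and some rows [f] give a nonzero minor. *)
Lemma chart_nonzero (x : 'I_(1 + p) -> k) :
  (forall f l, (d f l).@[x] = 0) -> forall j, x j = 0.
Proof.
move=> h j; apply/eqP; apply: contraT => xj.
pose B := col' j (map_mx (meval x) T).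
have fB : row_full B.
  rewrite /row_full -mxrank_tr; apply: inj_row_free => v /(congr1 trmx).
  rewrite trmx_mul trmxK trmx0 => Bv.
  pose y : 'cV[k]_(1 + p) := \col_i oapp (v 0) 0 (unlift j i).
  have [||c hc] := @T_ker x y; first by exists j.
    rewrite -Bv; apply/matrixP => a b; rewrite !mxE (bigD1_ord j) //= !mxE.
    rewrite unlift_none mulr0 add0r; apply: eq_bigr => i _.
    by rewrite !mxE liftK ord1.
  have c0 : c = 0.
    have /esym/eqP := hc j; rewrite mxE unlift_none /= mulf_eq0 (negbTE xj) orbF.
    by move=> /eqP.
  by apply/rowP => i; have := hc (lift j i); rewrite c0 mul0r !mxE liftK.
have := h (fullrankfun fB) j; rewrite rmorphM /= mevalXU minorE rmorphM /= rmorph_sign.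
have -> : (\det (rowsub (fullrankfun fB) (col' j T))).@[x] = \det (rowsub (fullrankfun fB) B).
  by rewrite -det_map_mx; congr (\det _); apply/matrixP => a b; rewrite !mxE.
move/eqP; rewrite !mulf_eq0 signr_eq0 (negbTE xj) /=; apply: contraTT => _.
by rewrite -unitfE -unitmxE fullrowsub_unit.
Qed.

(** The exponent 2(q + 1) bounds the exponents 2(m + 1) of [exact_mod_torsion] for all m <= q. *)
Lemma chart_cover : exists N, forall j, exists c : {ffun 'I_p -> 'I_r} * 'I_(1 + p) -> S,
  'X_j ^+ N = \sum_i c i * d i.1 i.2 ^+ q.+1.*2.
Proof.
apply: (@homog_nullstellensatz k _ _
  (fun i : {ffun 'I_p -> 'I_r} * 'I_(1 + p) => d i.1 i.2 ^+ q.+1.*2)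
  (fun=> (1 + p) * q.+1.*2)%N).
  move=> i; apply/dhomogMn/dhomogM; last exact: minor_homog.
  by rewrite dhomogX; apply/eqP/mdeg1.
move=> x hx; apply: chart_nonzero => f l.
have := hx (finfun f, l); rewrite rmorphXn /= => /eqP; rewrite expf_eq0 => /andP[_ /eqP <-].
congr (('X_l * \det _).@[x]); apply/matrixP => a b; rewrite !mxE.
by case: splitP => c _ //; rewrite !mxE ffunE.
Qed.
Local Notation R := {mpoly S[1 + p]}.
Variable N : nat.
Hypothesis N_cover : forall j, exists c : {ffun 'I_p -> 'I_r} * 'I_(1 + p) -> S,
  'X_j ^+ N = \sum_i c i * d i.1 i.2 ^+ q.+1.*2.
Local Notation J := (@taut_ideal k p N).

Let J0 j : J j 0. Proof. exact: taut_ideal0. Qed.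
Let JB j u v : J j u -> J j v -> J j (u - v). Proof. exact: taut_idealB. Qed.
Let JM j u v : J j v -> J j (u * v). Proof. exact: taut_idealM. Qed.
Let Jv j a u : J j u -> J j (vfield T a u). Proof. exact: taut_ideal_vfield. Qed.

(** The torsion bound for one chart. The integers to invert are b + c0, ..., b + m, which lie
    between 1 and q. *)
Lemma chart_exact j f l b m c0 psi : is_form b psi ->
    (forall s, size s = m.+1 -> J j (cobd T psi s)) -> (c0 <= 1)%N ->
    (0 < b + c0)%N -> (b + m <= q)%N ->
    ((0 < c0)%N -> forall s, size s = m ->
      J j (d f l *: mlin psi [seq eigvec (proj_mx T xv f l) (d f l) (false, a) | a <- s])) ->
  exact_mod T (J j) b m (fun s => d f l ^+ q.+1.*2 *: psi s).
Proof.
move=> fpsi cpsi c01 bc bm kpsi.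
have xE : d f l = xv l 0 * minor T f l by rewrite mxE.
have : exact_mod T (J j) b m (fun s => (xv l 0 * minor T f l) ^+ m.+1.*2 *: psi s).
  apply: (@exact_mod_torsion _ _ _ T (J j) (J0 j) (@JB j) (@JM j) (@Jv j) _ f
    (euler_coef T xv f l) (proj_coef T xv f l) (xv l 0 * minor T f l)
    _ _ _ _ b m c0 psi fpsi cpsi c01).
  - exact: euler_coef_homog.
  - exact: vfield_euler_coef.
  - exact: proj_mx_idem.
  - move=> e u hu; rewrite (euler_field Txv _ _ hu) addrAC subrr add0r.
    rewrite -scalerN -mulrN; apply: (idealZ (@JM j)); exact: taut_ideal_taut.
  - move=> i im; exists ((b + c0 + i)%:R^-1)%:MP.
    rewrite -(rmorph_nat (@mpolyC p.+1 k)) -rmorphM /= mulVf ?mpolyC1 //.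
    by apply: char_q; lia.
  - by rewrite -xE.

rewrite -xE => /(exact_modZ (J0 j) (@JB j) (@JM j) (d f l ^+ (q.+1.*2 - m.+1.*2))).
apply: exact_mod_ext => s; rewrite scalerA -exprD subnK //; lia.
Qed.

Lemma cover_exact i j b m psi :
    (forall f l, exact_mod T (J i) b m (fun s => d f l ^+ q.+1.*2 *: psi s)) ->
  exact_mod T (J i) b m (fun s => low_pow k p N j *: psi s).
Proof.
move=> h; have sum_exact (I : Type) (l : seq I) c D :
    (forall a, exact_mod T (J i) b m (fun s => D a *: psi s)) ->
    exact_mod T (J i) b m (fun s => (\sum_(a <- l) c a * D a) *: psi s).
  move=> hD; elim: l => [|a l IH].
    by apply: exact_mod_ideal => s _; rewrite big_nil scale0r.
  have := exact_mod_lin (J0 i) (@JB i) (@JM i) (c a) (hD a) IH.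
  by apply: exact_mod_ext => s; rewrite big_cons scalerDl scalerA.
have [jp|pj] := ltnP j p.+1; last first.
  apply: exact_mod_ideal => s _.
  by rewrite /low_pow insubF ?scale0r // ltnNge pj.
have [c hc] := N_cover (Ordinal jp); have := low_powE k N (Ordinal jp).
rewrite -mpolyXn hc /= => ->; apply: sum_exact => a; exact: h.
Qed.

Variable om : 'rV[S]_(1 + q + p).
Hypothesis om_homog : forall j, om 0 j \is q.-homog.
Hypothesis omT : om *m T = 0.
Variable g : {ffun 'I_p -> 'I_r} * 'I_(1 + p) -> S.
Hypothesis g_cover : 'X_0 ^+ N = \sum_i g i * d i.1 i.2.

(** On the left kernel of [T] this is X_0^N theta_f / mu_f, where mu_f = minor f l / X_l does not
    depend on l. The quotient does not depend on f either. *)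
Definition patched (s : seq 'I_r) : R :=
  (\sum_i g i * 'X_i.2 ^+ 2 * theta_form om i.1 s)%:MP.

Lemma patched_form : is_form 0 patched.
Proof.
split=> [s1 a b s2|s]; last by rewrite /patched -[_%:MP]mulr1 mul_mpolyC rpredZ ?dhomog1.
rewrite /patched -mpolyCN -sumrN; congr (_%:MP); apply: eq_bigr => i _.
by rewrite theta_form_skew mulrN.
Qed.

(* Multiplying by ['X_l ^+ 2] instead of dividing by minors keeps everything polynomial. *)
Lemma patched_ker (ws : seq 'rV[S]_r) : size ws = q ->
    {in ws, forall w, w *m T = 0} ->
  exists2 u : S, mlin patched ws = u%:MP &
    forall f l, d f l * u = 'X_l ^+ 2 * 'X_0 ^+ N * theta om f ws.
Proof.
move=> sq wT; exists (\sum_i g i * 'X_i.2 ^+ 2 * theta om i.1 ws) => [|f l].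
  rewrite rmorph_sum /=.
  rewrite (mlin_ext (phi := fun s => \sum_i (g i * 'X_i.2 ^+ 2) *:
    ((theta_form om i.1 s)%:MP : R))); last first.
    by move=> s _; rewrite /patched rmorph_sum; apply: eq_bigr => i _;
      rewrite rmorphM /= mul_mpolyC.
  by rewrite mlin_sum; apply: eq_bigr => i _; rewrite mlin_theta // rmorphM /= mul_mpolyC.
rewrite g_cover [LHS]mulr_sumr [X in _ = X * _]mulr_sumr mulr_suml; apply: eq_bigr => i _.
have /= e1 := minor_xv Txv f l i.2; rewrite !mxE in e1.
have e2 := theta_minor omT i.1 f i.2 wT.
(* [e1] exchanges the columns l and [i.2], and [e2] the row choices f and [i.1]. *)
transitivity (g i * 'X_l * 'X_i.2 * (minor T f l * 'X_i.2) * theta om i.1 ws); first by ring.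
rewrite -e1; transitivity (g i * 'X_l ^+ 2 * 'X_i.2 * (minor T f i.2 * theta om i.1 ws)).
  by ring.
by rewrite e2; ring.
Qed.

(** In degree b = 0 the first number to invert would be 0, so c0 = 1 is used. The corresponding
    kernel condition holds modulo X_0^N by [patched_ker], which is why the descent starts at the
    ideal of index 1. The primitive has degree 1, where [closed_exact] applies. *)
Lemma patched_exact : exists eta, forall s, size s = q -> J 1 (patched s - cobd T eta s).
Proof.
have tor j b m psi : (0 < b)%N -> (b + m = q)%N -> is_form b psi ->
    (forall s, size s = m.+1 -> J j (cobd T psi s)) ->
    exact_mod T (J j) b m (fun s => low_pow k p N j *: psi s).
  move=> b0 bm fpsi cpsi; apply: cover_exact => f l.
  by apply: (@chart_exact j f l b m 0) => //; lia.
have JS j u : J j.+1 u <-> exists y : R, J j (u - low_pow k p N j *: y).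
  exact: taut_idealS.
have reg j u : (j < p)%N -> J j (low_pow k p N j *: u) -> J j u.
  exact: taut_ideal_reg.
apply: (divide_exact J0 JB Jv JS reg) => [//||m th qm fth cth].
  apply: cover_exact => f l; apply: (@chart_exact 1 f l 0 q 1) => // [|s _|_ s sq].
  - exact: patched_form.
  - by rewrite cobd_homog0 // => t; apply: patched_form.2.
  set ms := map _ _; have ms_ker : {in ms, forall w, w *m T = 0}.
    by move=> w /mapP[a _ ->]; have := eigvec_ker Txv f l a; rewrite mxE.
  have sms : size ms = q by rewrite size_map.
  have [u -> hu] := patched_ker sms ms_ker.
  rewrite -mul_mpolyC -rmorphM /= hu; exists 0; rewrite mulr0 subr0 => e.
  rewrite mcoeffC mulrC; apply: low_idealM; rewrite -mulrA; apply: low_idealM.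
  have := low_powE k N (0 : 'I_p.+1).
  by rewrite -mpolyXn => <-; apply: low_ideal_pow.
have {}cth s : size s = m.+1 -> J 2 (cobd T th s) by rewrite -qm; apply: cth.
by apply: (closed_exact J0 JB Jv JS reg tor) fth cth => //; lia.
Qed.

(** Looks only at the term of degree 0 in the eps_i, to which the tautological element does not
    contribute. *)
Definition pow_coef i (u : R) := exists2 y : S, ord_ge i y & u@_0 = 'X_0 ^+ N * y.

Lemma pow_coef_taut u : J 1 u -> pow_coef 0 u.
Proof.
move=> [c /(_ 0%MM) /low_ideal_split [y hy]]; exists y => //.
have /eqP : (u - tautological xv * c)@_0 - low_pow k p N 0 * y = 0.
  apply/eqP; rewrite -msupp_eq0; case e: (msupp _) => [//|m s].
  by have [i] : exists2 i : 'I_p.+1, (i < 0)%N & (N <= m i)%N by apply: hy; rewrite e mem_head.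
rewrite subr_eq0 => /eqP; have := low_powE k N (0 : 'I_p.+1).
rewrite -mpolyXn => -> <-; rewrite mcoeffB.
have -> : (tautological xv * c)@_0 = 0.
  rewrite mulr_suml raddf_sum big1 //= => i _.
  by rewrite -scalerAl mcoeffZ mcoeffXUM mnm0E mulr0.
by rewrite subr0.
Qed.

Lemma pow_coef_mlin e (ws : seq 'rV[S]_r) psi :
    (forall w a, w \in ws -> ord_ge e (w 0 a)) ->
    (forall s, size s = size ws -> J 1 (psi s)) ->
  pow_coef (e * size ws) (mlin psi ws).
Proof.
elim: ws psi => [|w ws IH] psi hw hpsi; first by rewrite muln0; apply/pow_coef_taut/hpsi.
rewrite /=; apply: (big_ind (pow_coef _)) => [|u v [y hy ey] [z hz ez]|a _].
- by exists 0; [apply: ord_ge0 | rewrite mcoeff0 mulr0].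
- by exists (y + z); [apply: ord_geD | rewrite mcoeffD ey ez mulrDr].
have [||y hy ey] := IH (fun t => psi (a :: t)).
- by move=> v b vw; apply: hw; rewrite inE vw orbT.
- by move=> s sw; apply: hpsi; rewrite /= sw.
exists (w 0 a * y); first by rewrite mulnS; apply/ord_geM/hy/hw/mem_head.
by rewrite mcoeffZ ey mulrCA.
Qed.

Lemma proj_mx_homog f l a b : proj_mx T xv f l a b \is p.+1.-homog.
Proof.
have hm c : (T *m minor_adj T f l) a c \is p.-homog.
  rewrite mxE; apply: rpred_sum => i _.
  exact: (dhomogM (T_homog a i) (minor_adj_homog T_homog f l i c)).
have h1 c : proj_coef T xv f l a c \is p.+1.-homog.
  by rewrite /proj_coef mxE [xv l 0]mxE; apply: (dhomogM (X_homog l) (hm c)).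
have h0 c : (rowsub f 1%:M : 'M[S]_(p, r)) c b \is 0.-homog.
  by rewrite !mxE; case: (_ == _); rewrite ?dhomog1 ?dhomog0.
rewrite /proj_mx mxE; apply: rpred_sum => c _.
by have := dhomogM (h1 c) (h0 c); rewrite addn0.
Qed.

(** The exact form vanishes on the kernel vectors [ms], so the value u of the patched form there is
    X_0^N y. As the entries of [ms] have degree p + 1, y has order at least (p + 1) q. Comparing
    with [patched_ker] and [theta_scale] gives minor y = X_l d^q theta_form. *)
Lemma theta_form0 f l s : minor T f l != 0 -> size s = q -> theta_form om f s = 0.
Proof.
move=> nz sq; have [eta heta] := patched_exact.
set P := proj_mx T xv f l; pose ms := [seq eigvec P (d f l) (false, a) | a <- s].
have ms_ker : {in ms, forall w, w *m T = 0}.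
  by move=> w /mapP[a _ ->]; have := eigvec_ker Txv f l a; rewrite mxE.
have sms : size ms = q by rewrite size_map.
have [u eu hu] := patched_ker sms ms_ker.
have d_homog : d f l \is p.+1.-homog.
  exact: (dhomogM (X_homog l) (minor_homog T_homog f l)).
have [||y] := @pow_coef_mlin p.+1 ms (fun s => patched s - cobd T eta s).
- move=> w b /mapP[a _ ->]; apply: ord_ge_homog; rewrite /P.
  move: (proj_mx T xv f l) (proj_mx_homog f l) => Q hQ; rewrite !mxE eqxx /=.
  by rewrite rpredB ?hQ //; case: (b == a); rewrite ?mulr1 ?mulr0 ?rpred0 ?d_homog.
- by move=> t; rewrite sms; apply: heta.
rewrite sms => hy.
rewrite (mlin_ext (phi := fun t => (-1) *: cobd T eta t + patched t)); last first.
  by move=> t _; rewrite scaleN1r addrC.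
rewrite mlinP mlin_cobd_ker // scaler0 add0r eu mcoeffC eqxx mulr1 => uy.
have := hu f l; rewrite uy theta_scale // => e.
have nX i j : 'X_i ^+ j != 0 :> S by rewrite mpolyXn -msupp_eq0 msuppX.
have {}e : minor T f l * y = 'X_l * d f l ^+ q * theta_form om f s.
  apply: (mulfI (nX 0 N)); apply: (mulfI (nX l 1)).
  transitivity (d f l * ('X_0 ^+ N * y)); first by ring.
  by rewrite e; ring.
have dnz : d f l != 0 by rewrite mulf_neq0 // (nX l 1).
(* The left side has degree 1 + (p + 1) q + q but order at least p + (p + 1) q, and p = q + 2. *)
have t0 : 'X_l * d f l ^+ q * theta_form om f s = 0.
  apply: (@homog_ord_eq0 _ _ (1 + p.+1 * q + q) (p + p.+1 * q)); first by lia.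
    apply: dhomogM (dhomogM (X_homog l) (dhomogMn q d_homog)) _.
    exact: theta_form_homog.
  by rewrite -e; apply/ord_geM/hy/ord_ge_homog/minor_homog.
move/eqP: t0; rewrite !mulf_eq0 (negbTE (expf_neq0 q dnz)) orbF.
by rewrite (negbTE (nX l 1)) => /eqP.
Qed.

End Syzygy.

Section Alternating.
Variables (k : closedFieldType) (q : nat).
Local Notation p := q.+2.
Local Notation r := (1 + q + p)%N.
Local Notation S := {mpoly k[p.+1]}.
Variable (A : 'I_r -> 'M[k]_(1 + p)).
Hypothesis A_diag : forall a i, A a i i = 0.
Hypothesis A_skew : forall a i j, A a i j = - A a j i.
Hypothesis char_q : forall i, (0 < i <= q)%N -> i%:R != 0 :> k.

Definition pencil_mx : 'M[S]_(r, 1 + p) := \matrix_(a, i) \sum_j A a j i *: 'X_j.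

Theorem syzygy_eq0 (om : 'rV[S]_r) :
    (forall x y : 'I_(1 + p) -> k, (exists i, x i != 0) ->
      (forall a, \sum_i \sum_j A a i j * (x i * y j) = 0) ->
      exists c, forall i, y i = c * x i) ->
    (forall a, om 0 a \is q.-homog) -> om *m pencil_mx = 0 -> om = 0.
Proof.
move=> A_ker om_homog omT.
have T_homog a i : pencil_mx a i \is 1.-homog.
  rewrite mxE; apply: rpred_sum => j _; apply: rpredZ.
  by rewrite dhomogX; apply/eqP/mdeg1.
have Txv : pencil_mx *m (\col_i 'X_i) = 0.
  apply/matrixP => a b; rewrite !mxE.
  transitivity (\sum_i \sum_j A a j i *: ('X_j * 'X_i) : S).
    by apply: eq_bigr => i _; rewrite !mxE mulr_suml; apply: eq_bigr => j _; rewrite scalerAl.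
  rewrite sum_pairs => [|i]; last by rewrite A_diag scale0r.
  rewrite big1 // => i _; rewrite A_skew mulrC scaleNr.
  by rewrite addNr.
have T_ker (x : 'I_(1 + p) -> k) (y : 'cV[k]_(1 + p)) :
    (exists i, x i != 0) -> map_mx (meval x) pencil_mx *m y = 0 ->
    exists c, forall i, y i 0 = c * x i.
  move=> xn e; apply: (A_ker x (fun i => y i 0)) => // a.
  have /matrixP/(_ a 0) := e; rewrite !mxE => e0; apply: etrans e0; rewrite exchange_big /=.
  apply: eq_bigr => i _; rewrite !mxE raddf_sum mulr_suml; apply: eq_bigr => j _.
  by rewrite /= mevalZ mevalXU mulrA.
have [N hN] := chart_cover T_homog T_ker.
have [g hg] := hN 0.
pose nz (i : {ffun 'I_p -> 'I_r} * 'I_(1 + p)) := minor pencil_mx i.1 i.2 != 0.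
have [i ni|z] := pickP nz.
  apply: (theta_form_eq0 omT ni) => s sq.
  (* All but one of the factors d in the powers of the cover are moved into the coefficients. *)
  pose g' (i : {ffun 'I_p -> 'I_r} * 'I_(1 + p)) :=
    g i * ('X_i.2 * minor pencil_mx i.1 i.2) ^+ (q.+1.*2).-1.
  have hg' : 'X_0 ^+ N = \sum_i g' i * ('X_i.2 * minor pencil_mx i.1 i.2).
    by rewrite hg; apply: eq_bigr => j _; rewrite -mulrA -exprSr.
  exact: (theta_form0 T_homog Txv char_q hN om_homog omT hg' ni sq).
(* If all minors vanished, [chart_nonzero] at the point (1, ..., 1) would give 1 = 0. *)
have /eqP : (1 : k) = 0.
  apply: (chart_nonzero T_ker (x := fun=> 1)) => // [f l|]; last exact: ord0.
  have -> : minor pencil_mx f l = minor pencil_mx (finfun f) l.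
    congr (\det _); apply/matrixP => a b; rewrite !mxE.
    by case: splitP => c _ //; rewrite !mxE ffunE.
  by have /negbFE/eqP -> := z (finfun f, l); rewrite mulr0 meval0.
by rewrite oner_eq0.
Qed.

End Alternating.

Theorem syzygy_free (k : closedFieldType) n r (A : 'I_r -> 'M[k]_n)
    (om : 'I_r -> {mpoly k[n]}) :
    (3 <= n)%N -> r = (2 * n - 3)%N ->
    (forall a i, A a i i = 0) -> (forall a i j, A a i j = - A a j i) ->
    (forall i, (0 < i <= n - 3)%N -> i%:R != 0 :> k) ->
    (forall x y : 'I_n -> k, (exists i, x i != 0) ->
      (forall a, \sum_i \sum_j A a i j * (x i * y j) = 0) ->
      exists c, forall i, y i = c * x i) ->
    (forall a, om a \is (n - 3).-homog) ->
    (forall i, \sum_a om a * (\sum_j A a i j *: 'X_j) = 0) ->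
  forall a, om a = 0.
Proof.
move=> n3; have [q en] : exists q, n = q.+3 by exists (n - 3)%N; lia.
move: A om n3; rewrite {n}en => A om _ er.
have {}er : r = (1 + q + q.+2)%N by lia.
move: A om; rewrite {r}er subSS subSS subSS subn0 => A om A_diag A_skew char_q A_ker hom e a.
have /rowP/(_ a) : \row_a om a = 0 :> 'rV_(1 + q + q.+2).
  apply: (syzygy_eq0 A_diag A_skew char_q A_ker) => [b|]; first by rewrite mxE.
  apply/rowP => i; rewrite !mxE -[RHS]oppr0 -[X in - X](e i) -sumrN.
  apply: eq_bigr => b _; rewrite !mxE -mulrN -sumrN; congr (_ * _).
  by apply: eq_bigr => j _; rewrite (A_skew b j i) scaleNr.
by rewrite !mxE.
Qed.

(** * Points of the Chow form *)

Section Coordinates.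
Variables (k : fieldType) (V : vectType k).
Local Notation n := (\dim {:V}).

Lemma ext2_eq (C : vectType k) (f g : ext2 V -> C) : linear f -> linear g ->
  (forall v w, f (wedge v w) = g (wedge v w)) -> f =1 g.
Proof.
move=> fl gl fg a; rewrite -(linfunE fl) -(linfunE gl); congr (fun_of_lfun _ a).
by apply: ext2_ext => v w; rewrite !linfunE.
Qed.

(** Interior product with the i-th coordinate form; its coordinates form the skew matrix [alt_entry]
    of a bivector. *)
Definition contract i : 'Hom(ext2 V, V) :=
  ext2_lift (fun v w => coord (vbasis {:V}) i v *: w - coord (vbasis {:V}) i w *: v).

Lemma contract_wedge i v w : contract i (wedge v w) =
  coord (vbasis {:V}) i v *: w - coord (vbasis {:V}) i w *: v.
Proof.
rewrite /contract ext2_liftE // => [|x]; last by rewrite subrr.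
split=> [y c a b|y c a b].
  rewrite linearP /= scalerDl scalerDr scalerBr !scalerA opprD addrACA.
  by rewrite [_ y * c]mulrC.
rewrite linearP /= [X in _ - X *: _]linearP scalerDl scalerBr !scalerA opprD addrACA.
by [].
Qed.

Definition alt_entry (a : ext2 V) : 'M[k]_n :=
  \matrix_(i, j) coord (vbasis {:V}) j (contract i a).

Lemma alt_entryN a i j : alt_entry a i j = - alt_entry a j i.
Proof.
rewrite !mxE; move: a; apply: (@ext2_eq k^o) => [c x y|c x y|v w].
- by rewrite !linearP.
- by rewrite !linearP /= opprD scalerN.
by rewrite !contract_wedge !linearB !linearZ /=; ring.
Qed.

Lemma alt_entry_diag a i : alt_entry a i i = 0.
Proof.
rewrite !mxE; move: a; apply: (@ext2_eq k^o) => [c x y|c x y|v w].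
- by rewrite !linearP.
- by rewrite scaler0 addr0.
by rewrite !contract_wedge !linearB !linearZ /=; ring.
Qed.

Lemma lfun_coord (xi : dual V) v : xi v = \sum_i coord (vbasis {:V}) i v * xi (vb V i).
Proof.
by rewrite {1}(coord_vbasis (memvf v)) linear_sum; apply: eq_bigr => i _; rewrite linearZ.
Qed.

Lemma pairing_entry (xi eta : dual V) a : ext2_pairing V (wedge xi eta) a =
  \sum_i \sum_j alt_entry a i j * (xi (vb V i) * eta (vb V j)).
Proof.
move: a; apply: (@ext2_eq k^o) => [c x y|c x y|v w]; first exact: linearP.
  rewrite scaler_sumr -big_split; apply: eq_bigr => i _ /=.
  rewrite scaler_sumr -big_split; apply: eq_bigr => j _ /=.
  by rewrite !mxE !linearP /= mulrDl scalerAl.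
rewrite ext2_pairing_wedge (lfun_coord xi v) (lfun_coord eta v)
  (lfun_coord xi w) (lfun_coord eta w).
rewrite !mulr_suml -sumrB; apply: eq_bigr => i _.
rewrite !mulr_sumr -sumrB; apply: eq_bigr => j _.
by rewrite mxE contract_wedge linearB !linearZ /=; rewrite /GRing.scale /=; ring.
Qed.

Variable m : nat.

Definition component i : 'Hom(tens V (sym m V), sym m V) :=
  tens_lift (fun v (g : sym m V) => coord (vbasis {:V}) i v *: g).

Lemma component_tensor i v g :
  component i (tensor v g) = coord (vbasis {:V}) i v *: g.
Proof.
rewrite /component tens_liftE //; split=> [y c a b|y c a b].
  by rewrite linearP scalerDl scalerA.
by rewrite scalerDr !scalerA mulrC.
Qed.

Lemma tensE (t : tens V (sym m V)) : t = \sum_(i < n) tensor (vb V i) (component i t).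
Proof.
pose h t := \sum_(i < n) tensor (vb V i) (component i t).
have hl : linear h.
  move=> c x y; rewrite /h scaler_sumr -big_split; apply: eq_bigr => i _ /=.
  by rewrite linearP (tensor_bilinear _ _).2.
rewrite -[RHS](linfunE hl) -[LHS](id_lfunE t); congr (fun_of_lfun _ t).
apply: tens_ext => v g; rewrite id_lfunE linfunE // /h.
rewrite {1}(coord_vbasis (memvf v)) (linear_sumZ ((tensor_bilinear V (sym m V)).1 _)).
apply: eq_bigr => i _; rewrite component_tensor.
by apply/matrixP => a b; rewrite !mxE linearZ /= mulrCA.
Qed.

End Coordinates.

Section Koszul.
Variables (k : fieldType) (V : vectType k) (q : nat).
Local Notation n := (\dim {:V}).

Lemma component_delta2 i (a : ext2 V) (f : sym q V) :
  component q.+1 i (delta2 V q (tensor a f)) = symmul (contract i a) f.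
Proof.
move: a; apply: (@ext2_eq k V (sym q.+1 V)) => [c x y|c x y|v w].
- by rewrite (tensor_bilinear _ _).1 !linearP.
- by rewrite linearP (symmul_bilinear _ _).1.
rewrite delta2_wedge linearB /= !component_tensor contract_wedge.
have sl := (@symmul_bilinear k V q).1 f.
by rewrite -[RHS](linfunE sl) linearB !linearZ /= !(linfunE sl).
Qed.

Lemma val_component_delta2 i (a : ext2 V) (f : sym q V) :
  val (component q.+1 i (delta2 V q (tensor a f))) =
  (\sum_j alt_entry a i j *: 'X_j) * val f.
Proof.
rewrite component_delta2 /=; congr (_ * _); rewrite /lin_form.
by apply: eq_bigr => j _; rewrite mxE.
Qed.

(** Read component by component in [V], the kernel condition is the syzygy equation for the pencil
    of the skew matrices of the [a b]. *)
Lemma delta2_sum_eq0 (I : finType) (a : I -> ext2 V) (f : I -> sym q V) :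
  delta2 V q (\sum_b tensor (a b) (f b)) = 0 <->
  forall i, \sum_b val (f b) * (\sum_j alt_entry (a b) i j *: 'X_j) = 0.
Proof.
have e i : val (component q.+1 i (delta2 V q (\sum_b tensor (a b) (f b)))) =
    \sum_b val (f b) * (\sum_j alt_entry (a b) i j *: 'X_j).
  rewrite !linear_sum.
  apply: eq_bigr => b _.
  exact: etrans (val_component_delta2 i (a b) (f b)) (mulrC _ _).
split=> [d0 i|h]; first by rewrite -e d0 linear0.
rewrite [LHS]tensE big1 // => i _.
have -> : component q.+1 i (delta2 V q (\sum_b tensor (a b) (f b))) = 0.
  by apply: val_inj; rewrite e h.
by apply/matrixP => x y; rewrite !mxE linear0 mulr0.
Qed.

Lemma tensv_repr (A B : vectType k) (U : {vspace A}) (t : tens A B) : t \in tensv U {:B} ->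
  exists f : 'I_(\dim U) -> B, t = \sum_(b < \dim U) tensor (vbasis U)`_b (f b).
Proof.
have tD u : linear (@tensor k A B u) by exact: (tensor_bilinear A B).2.
pose X := [seq tensor u w | u <- vbasis U, w <- vbasis {:B}].
move=> tU; rewrite (coord_span (X := in_tuple X) tU).
apply: (big_ind (fun t => exists f : 'I_(\dim U) -> B,
  t = \sum_(b < \dim U) tensor (vbasis U)`_b (f b))).
- exists (fun=> 0); rewrite big1 // => b _.
  by apply/matrixP => x y; rewrite !mxE linear0 mulr0.
- move=> _ _ [f ->] [g ->]; exists (fun b => f b + g b).
  rewrite -big_split; apply: eq_bigr => b _ /=.
  by have := tD (vbasis U)`_b 1 (f b) (g b); rewrite !scale1r.
move=> i _; set c := coord _ _ _.
have : (in_tuple X)`_i \in X by apply: mem_nth.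
case/allpairsP => [[u w] /= [/tnthP[b ->] _ ->]].
exists (fun b' => (b' == b)%:R * c *: w); rewrite (bigD1 b) //= big1 => [|b' /negbTE ->].
  rewrite eqxx mul1r addr0 (tnth_nth 0).
  by apply/matrixP => x y; rewrite !mxE linearZ /= mulrCA.
by apply/matrixP => x y; rewrite !mxE mul0r scale0r linear0 mulr0.
Qed.

End Koszul.

Section ChowPoints.
Variables (k : fieldType) (V : vectType k) (K : {vspace ext2 V}).
Local Notation n := (\dim {:V}).

Lemma wedge_eq0 (W : vectType k) (x y : W) : x != 0 -> wedge x y = 0 ->
  exists c, y = c *: x.
Proof.
move=> x0 /ffunP xy; have fV := basis_free (vbasisP {:W}).
have [i xi] : exists i, coord (vbasis {:W}) i x != 0.
  apply/existsP; apply: contraNT x0 => /existsPn h; apply/eqP.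
  rewrite (coord_vbasis (memvf x)) big1 // => i _.
  by have := h i; rewrite negbK => /eqP ->; rewrite scale0r.
exists (coord (vbasis {:W}) i y / coord (vbasis {:W}) i x).
have e j : coord (vbasis {:W}) i x * coord (vbasis {:W}) j y =
           coord (vbasis {:W}) j x * coord (vbasis {:W}) i y.
  have [lt|lt|/val_inj ->//] := ltngtP i j.
    by have /eqP := xy (Sub (i, j) lt); rewrite !ffunE subr_eq0 => /eqP.
  by have /eqP := xy (Sub (j, i) lt); rewrite !ffunE subr_eq0 => /eqP.
rewrite {1}(coord_vbasis (memvf y)) [X in _ *: X](coord_vbasis (memvf x)) scaler_sumr.
apply: eq_bigr => j _; rewrite scalerA; congr (_ *: _).
by apply: (mulfI xi); rewrite e; field.
Qed.

Lemma ext2v_line (W : vectType k) (x y : W) :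
  ext2v <<[:: y; x]>> = <[wedge x y]>%VS.
Proof.
have wlin := @wedge_bilinear k W.
apply: subv_anti; rewrite -memvE mem_ext2v ?memv_span ?inE ?eqxx ?orbT // andbT.
have key u w : u \in <<[:: y; x]>>%VS -> w \in <<[:: y; x]>>%VS ->
    wedge u w \in <[wedge x y]>%VS.
  rewrite span_cons span_seq1 => /memv_addP[_ /vlineP[a ->] [_ /vlineP[b ->] ->]].
  move=> /memv_addP[_ /vlineP[c ->] [_ /vlineP[e ->] ->]].
  apply/vlineP; exists (b * c - a * e); apply/ffunP => p.
  by rewrite !ffunE !linearD !linearZ /= /GRing.scale /=; ring.
apply/span_subvP => _ /allpairsP[[u w] /= [uU wU ->]].
by apply: key; apply: vbasis_mem.
Qed.

Lemma ChowP : Chow K <-> \dim K = (2 * n - 3)%N /\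
  exists x y : dual V, wedge x y != 0 /\
    forall a, a \in K -> ext2_pairing V (wedge x y) a = 0.
Proof.
split=> [[/andP[_ /eqP dK] [L /andP[LK /eqP L1] [U _ LU]]]|[dK [x [y [xy h]]]]].
  split=> //.
  have [/allP all0|/allPn] := boolP (all (eq_op^~ 0)
    [seq wedge u w | u <- vbasis U, w <- vbasis U]).
    suff : (L <= 0)%VS by rewrite subv0 -dimv_eq0 L1.
    by rewrite LU; apply/span_subvP => u /all0 /eqP ->; apply: mem0v.
  move=> [_ /allpairsP[[u w] /= [uU wU ->]] uw]; exists u, w; split=> // a aK.
  have /mem_orthv : wedge u w \in orthv K.
    by apply: (subvP LK); rewrite LU mem_ext2v // vbasis_mem.
  exact.
split; first by rewrite inE /= subvf dK eqxx.
exists (ext2v <<[:: y; x]>>).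
  by rewrite ext2v_line inE /= dim_vline xy eqxx andbT -memvE; apply/mem_orthv.
exists <<[:: y; x]>>%VS => //; rewrite inE /= subvf /=.
suff : free [:: y; x] by [].
rewrite free_cons seq1_free span_seq1.
have wlin := @wedge_bilinear k (dual V).
apply/andP; split; apply: contra xy.
  move=> /vlineP[c ->]; apply/eqP/ffunP => p.
  by rewrite !ffunE !linearZ /=; ring.
by move=> /eqP ->; apply/eqP/ffunP => p; rewrite !ffunE !linear0 !mul0r subrr.
Qed.

End ChowPoints.

Lemma linear_form_basis (k : fieldType) (V : vectType k) (x : 'I_(\dim {:V}) -> k) :
  exists xi : dual V, forall i : 'I_(\dim {:V}), xi (vb V i) = x i.
Proof.
pose f (v : V) : k^o := \sum_i coord (vbasis {:V}) i v * x i.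
have fl : linear f.
  move=> c u v; rewrite /f scaler_sumr -big_split; apply: eq_bigr => i _ /=.
  by rewrite linearP /= mulrDl scalerAl.
exists (linfun f : dual V) => i; rewrite linfunE // /f (bigD1 i) //= big1 => [|j ji].
  by rewrite addr0 coord_free ?eqxx ?mul1r ?(basis_free (vbasisP _)).
rewrite coord_free ?(basis_free (vbasisP _)) //.
by rewrite -[_ == _]/(i == j :> nat) eq_sym (inj_eq val_inj) (negbTE ji) mul0r.
Qed.

(** The coefficients of t on a basis of [K] form a syzygy. If its kernel condition failed for x and
    y, the forms xi and eta with these coordinates would satisfy xi /\ eta <> 0 and annihilate [K],
    giving a point of the Chow form. *)
Lemma koszul_injective (k : closedFieldType) (V : vectType k) (K : {vspace ext2 V})
    (q := (\dim {:V} - 3)%N) t :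
    (3 <= \dim {:V})%N -> (forall i, (0 < i <= q)%N -> i%:R != 0 :> k) ->
    \dim K = (2 * \dim {:V} - 3)%N -> ~ Chow K ->
    t \in tensv K {:sym q V} -> delta2 V q t = 0 -> t = 0.
Proof.
move=> n3 char_q dK nChow /tensv_repr[f ->] /delta2_sum_eq0 h.
rewrite big1 // => b _.
suff -> : f b = 0 by apply/matrixP => x y; rewrite !mxE linear0 mulr0.
apply: val_inj; apply: (syzygy_free n3 dK _ _ char_q _ _ h) => [a i|a i j|x y [i0 xi0] h0|a].
- exact: alt_entry_diag.
- exact: alt_entryN.
- have [xi hxi] := linear_form_basis x; have [eta heta] := linear_form_basis y.
  have xi_neq0 : xi != 0.
    by apply: contra_neq xi0 => e; rewrite -hxi e lfunE.
  have [/eqP/(wedge_eq0 xi_neq0)[c ec]|nz] := boolP (wedge xi eta == 0).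
    by exists c => i; rewrite -heta ec scale_lfunE hxi.
  case: nChow; apply/ChowP; split=> //; exists xi, eta; split=> // a aK.
  rewrite (coord_vbasis aK) linear_sum big1 // => b' _.
  rewrite linearZ /= pairing_entry.
  under eq_bigr do under eq_bigr do rewrite hxi heta.
  by rewrite h0 scaler0.
exact: dhomog_is_dhomog.
Qed.

(** * The dimension count *)

Lemma dhomog_dim (k : fieldType) n d : (0 < n)%N ->
  Vector.axiom 'C(d + n.-1, d) (dhomog n k d).
Proof. by case: n => // n _; apply: dhomog_vecaxiom. Qed.

Lemma axiom_dim (k : fieldType) (W : vectType k) d : Vector.axiom d W -> \dim {:W} = d.
Proof.
move=> [g gl [h hg gh]].
have gE := linfunE gl.
have ker0 : (fullv :&: lker (linfun g) = 0)%VS.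
  apply/eqP; rewrite -subv0; apply/subvP => w; rewrite memv_cap memv_ker gE => /andP[_ /eqP e].
  have g0 : g 0 = 0 by have := gl (-1) 0 0; rewrite scaler0 addr0 scaleN1r addNr.
  by rewrite memv0 -(hg w) e -g0 hg.
have := limg_dim_eq ker0; have -> : (linfun g @: fullv = fullv)%VS.
  by apply: subv_anti; rewrite subvf; apply/subvP => w _; rewrite -(gh w) -gE memv_img ?memvf.
by move=> <-; rewrite dimvf dim_matrix; exact: mul1n.
Qed.

Lemma sym_dim (k : fieldType) (V : vectType k) d : (0 < \dim {:V})%N ->
  \dim {:sym d V} = 'C(d + (\dim {:V}).-1, d).
Proof. by move=> n0; apply: axiom_dim; apply: dhomog_dim. Qed.

(** With n = q + 3 this reads (2n - 3) dim Sym^q + dim Sym^(q+2) = n dim Sym^(q+1). *)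
Lemma binomial_syzygy q : ((2 * q.+3 - 3) * 'C(q + q.+2, q) + 'C(q.+2 + q.+2, q.+2) =
  q.+3 * 'C(q.+1 + q.+2, q.+1))%N.
Proof.
have e1 : ((2 * q.+3 - 3) * 'C(q + q.+2, q) = q.+1 * 'C(q.+1 + q.+2, q.+1))%N.
  by rewrite -mul_bin_diag; congr (_ * 'C(_, _))%N; lia.
have e2 : 'C(q.+2 + q.+2, q.+2) = (2 * 'C(q.+1 + q.+2, q.+1))%N.
  rewrite [in LHS]addSn binS -[X in (X + _)%N]bin_sub ?leq_addl //.
  by rewrite addnK addnn mul2n.
by rewrite e1 e2 -mulnDl addn2.
Qed.

Section Dimension.
Variables (k : fieldType) (V : vectType k) (q : nat).
Local Notation n := (\dim {:V}).

Definition symmul_lift : 'Hom(tens V (sym q V), sym q.+1 V) := tens_lift (@symmul k V q).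

Lemma symmul_liftE v g : symmul_lift (tensor v g) = symmul v g.
Proof. by rewrite /symmul_lift tens_liftE //; apply: symmul_bilinear. Qed.

Lemma symmul_lift_surj : limg symmul_lift = fullv.
Proof.
apply: subv_anti; rewrite subvf; apply/subvP => g _.
suff H (p : {mpoly k[n]}) : p \is q.+1.-homog -> exists t, val (symmul_lift t) = p.
  have [t et] := H _ (dhomog_is_dhomog g).
  by rewrite -(val_inj et) memv_img ?memvf.
move=> /dhomogP hp; rewrite [p]mpolyE big_seq.
apply: (big_ind (fun p => exists t, val (symmul_lift t) = p)).
- by exists 0; rewrite linear0.
- by move=> _ _ [t <-] [u <-]; exists (t + u); rewrite linearD.
move=> m /hp /= dm; have [i mi] : exists i, (0 < m i)%N.
  apply/existsP; apply: contra_eqT dm => /existsPn h; rewrite mdegE big1 // => i _.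
  by have := h i; rewrite -eqn0Ngt => /eqP.
have hX : 'X_[m - U_(i)] \is [in k[n], q.-homog].
  rewrite dhomogX; have : mdeg (m - U_(i) + U_(i))%MM == q.+1.
    by rewrite submK ?dm // lep1mP -lt0n.
  by rewrite mdegD mdeg1 addn1 eqSS.
exists (p@_m *: tensor (vb V i) (DHomog hX : sym q V)).
rewrite linearZ /= symmul_liftE /= /lin_form; congr (_ *: _).
rewrite (bigD1 i) //= coord_free ?(basis_free (vbasisP _)) // eqxx scale1r big1 ?addr0.
  by rewrite -mpolyXD addmC submK // lep1mP -lt0n.
move=> j ji; rewrite coord_free ?(basis_free (vbasisP _)) //.
by rewrite -[_ == _]/(i == j :> nat) eq_sym (inj_eq val_inj) (negbTE ji) scale0r.
Qed.

(** Multiplication by the coordinate matrix [C] of a basis of [K] is injective with values in the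
    subspace. *)
Lemma dim_tensv (A B : vectType k) (K : {vspace A}) :
  (\dim K * \dim {:B} <= \dim (tensv K {:B}))%N.
Proof.
pose C : 'M[k]_(\dim {:A}, \dim K) := \matrix_(i, b) coord (vbasis {:A}) i (vbasis K)`_b.
pose phi (M : 'M[k]_(\dim K, \dim {:B})) : tens A B := C *m M.
have phil : linear phi by move=> c M N; rewrite /phi mulmxDr scalemxAr.
have ker0 : (fullv :&: lker (linfun phi) = 0)%VS.
  apply/eqP; rewrite -subv0; apply/subvP => M.
  rewrite memv_cap memv_ker linfunE // => /andP[_ /eqP e].
  rewrite memv0; apply/eqP/matrixP => b j; rewrite mxE.
  suff : forall b, (fun b => M b j) b = 0 by apply.
  apply/(@freeP _ _ _ (vbasis K)); first exact: basis_free (vbasisP K).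
  rewrite [LHS](coord_vbasis (memvf _)) big1 // => i _.
  have /matrixP/(_ i j) := e; rewrite !mxE => ei.
  rewrite linear_sum (_ : \sum_b _ = 0) ?scale0r // -[RHS]ei.
  by apply: eq_bigr => b' _; rewrite linearZ mxE mulrC.
have -> : (\dim K * \dim {:B})%N = \dim (linfun phi @: fullv).
  by rewrite (limg_dim_eq ker0) [RHS]dimvf [RHS]dim_matrix.
apply: dimvS.
apply/subvP => _ /memv_imgP[M _ ->]; rewrite linfunE //.
have -> : phi M = \sum_(b < \dim K) tensor (vbasis K)`_b
    (\sum_(j < \dim {:B}) M b j *: vb B j).
  apply/matrixP => i j; rewrite summxE mxE; apply: eq_bigr => b _.
  rewrite !mxE; congr (_ * _); rewrite linear_sum (bigD1 j) //= big1 => [|j' nj].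
    by rewrite addr0 linearZ /= coord_free ?(basis_free (vbasisP _)) // eqxx mulr1.
  rewrite linearZ /= coord_free ?(basis_free (vbasisP _)) //.
  by rewrite -[_ == _]/(j' == j :> nat) (inj_eq val_inj) (negbTE nj) mulr0.
apply: memv_suml => b _; apply: mem_tensv; last exact: memvf.
by apply: vbasis_mem; apply: mem_nth; rewrite size_tuple.
Qed.

End Dimension.

(** * Non-injectivity at a point of the Chow form *)

Section ChowKernel.
Variables (k : fieldType) (V : vectType k) (q : nat) (xi eta : dual V).
Local Notation n := (\dim {:V}).

Definition eval_at m (g : sym m V) : k := (val g).@[fun i : 'I_n => xi (vb V i)].

Lemma eval_at_linear m : linear (@eval_at m : sym m V -> k^o).
Proof. by move=> c g h; rewrite /eval_at /= mevalD mevalZ. Qed.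

Lemma eval_at_symmul v (g : sym q V) :
  eval_at (symmul v g) = xi v * eval_at g.
Proof.
rewrite /eval_at /= mevalM; congr (_ * _); rewrite /lin_form raddf_sum lfun_coord.
by apply: eq_bigr => i _; rewrite /= mevalZ mevalXU.
Qed.

Definition chow_functional : 'Hom(tens V (sym q.+1 V), k^o) :=
  tens_lift (fun v (g : sym q.+1 V) => eta v * eval_at g : k^o).

Lemma chow_functional_delta2 a (f : sym q V) :
  chow_functional (delta2 V q (tensor a f)) =
  - (ext2_pairing V (wedge xi eta) a * eval_at f).
Proof.
move: a; apply: (@ext2_eq k V k^o) => [c x y|c x y|v w].
- by rewrite (tensor_bilinear _ _).1 !linearP.
- move: (ext2_pairing V (wedge xi eta) : 'Hom(ext2 V, k^o)) => h.
  have -> : h (c *: x + y) = c * h x + h y by exact: linearP.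
  by transitivity (c * - (h x * eval_at f) - h y * eval_at f); first by ring.
have bil : bilinear_map (fun v (g : sym q.+1 V) => eta v * eval_at g : k^o).
  split=> [y c x z|y c x z].
    have -> : eta (c *: x + z) = c * eta x + eta z by exact: linearP.
    by rewrite mulrDl -mulrA.
  have -> : eval_at (c *: x + z) = c * eval_at x + eval_at z.
    exact: eval_at_linear.
  by rewrite mulrDr mulrCA.
rewrite delta2_wedge linearB /= /chow_functional !tens_liftE // ext2_pairing_wedge.
by rewrite !eval_at_symmul; ring.
Qed.

Lemma symmul_lift_delta2 t : symmul_lift V q.+1 (delta2 V q t) = 0.
Proof.
have e : (symmul_lift V q.+1 \o delta2 V q = 0)%VF.
  apply: tens_ext => a f; rewrite comp_lfunE lfunE /=.
  move: a; apply: (@ext2_eq k V (sym q.+2 V)) => [c x y|c x y|v w].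
  - by rewrite (tensor_bilinear _ _).1 !linearP.
  - by rewrite scaler0 addr0.
  rewrite delta2_wedge linearB /= !symmul_liftE.
  by apply: val_inj; rewrite /= mulrCA subrr.
by have /lfunP/(_ t) := e; rewrite comp_lfunE lfunE.
Qed.

Lemma chow_kernel (K : {vspace ext2 V}) : (n = q.+3)%N -> \dim K = (2 * n - 3)%N ->
    wedge xi eta != 0 -> (forall a, a \in K -> ext2_pairing V (wedge xi eta) a = 0) ->
  (tensv K {:sym q V} :&: lker (delta2 V q))%VS <> 0%VS.
Proof.
move=> en dK nz hK /limg_dim_eq; set D := (delta2 V q @: _)%VS => dD.
have Dmu : (D <= lker (symmul_lift V q.+1))%VS.
  apply/subvP => _ /memv_imgP[t _ ->].
  by rewrite memv_ker symmul_lift_delta2.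
have Dlam : (D <= lker chow_functional)%VS.
  apply/subvP => _ /memv_imgP[t /tensv_repr[f ->] ->]; rewrite memv_ker !linear_sum.
  rewrite big1 // => b _; rewrite /= chow_functional_delta2 hK ?mul0r ?oppr0 //.
  by apply: vbasis_mem; apply: mem_nth; rewrite size_tuple.
have [l xl] : exists l : 'I_n, xi (vb V l) != 0.
  apply/existsP; apply: contraNT nz => /existsPn h.
  have -> : xi = 0.
    by apply/lfunP => v; rewrite lfun_coord big1 ?lfunE // => i _;
      have := h i; rewrite negbK => /eqP ->; rewrite mulr0.
  by apply/eqP/ffunP => p; rewrite !ffunE !linear0 !mul0r subrr.
(* If xi /\ eta vanished on all v_l /\ v_j, then eta would be the multiple of xi with ratio eta(v_l)
   / xi(v_l). *)
have [j wj] : exists j : 'I_n, ext2_pairing V (wedge xi eta) (wedge (vb V l) (vb V j)) != 0.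
  apply/existsP; apply: contraNT nz => /existsPn h.
  have -> : eta = (eta (vb V l) / xi (vb V l)) *: xi.
    apply/lfunP => v; rewrite scale_lfunE (lfun_coord eta) (lfun_coord xi v) scaler_sumr.
    apply: eq_bigr => i _; have := h i; rewrite negbK ext2_pairing_wedge subr_eq0 => /eqP e.
    by rewrite /GRing.scale /=; apply: (mulfI xl); rewrite mulrCA e; field.
  by apply/eqP/ffunP => p; rewrite !ffunE !linearZ /=; ring.
(* The polynomial X_l^q takes the value xi(v_l)^q <> 0 at xi, so the image [e] is not killed by the
   functional. *)
have hX : 'X_[U_(l) *+ q] \is [in k[n], q.-homog].
  by rewrite dhomogX /= mdegMn mdeg1 mul1n.
pose e := delta2 V q (tensor (wedge (vb V l) (vb V j)) (DHomog hX : sym q V)).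
have lt : (\dim D < \dim (lker (symmul_lift V q.+1)))%N.
  rewrite (ltn_leqif (dimv_leqif_sup Dmu)); apply/negP => /subvP/(_ e).
  rewrite memv_ker symmul_lift_delta2 eqxx => /(_ isT) /(subvP Dlam).
  rewrite memv_ker chow_functional_delta2 oppr_eq0 mulf_eq0 (negbTE wj) /=.
  by rewrite /eval_at /= -mpolyXn rmorphXn /= mevalXU expf_eq0 (negbTE xl) andbF.
(* By rank-nullity and the binomial identity, the kernel has dimension (2n - 3) dim Sym^q, which is
   at most that of the source; this contradicts the strict inclusion of the image. *)
have := limg_ker_dim (symmul_lift V q.+1) fullv.
rewrite capfv symmul_lift_surj; have := dim_tensv (sym q V) K.
rewrite !sym_dim ?en // -dD dK [\dim {:tens _ _}]dimvf dim_matrix sym_dim ?en //=.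
have := binomial_syzygy q; move: lt; rewrite ?en /=.
move: (\dim D) (\dim (lker _)) => a b; lia.
Qed.

End ChowKernel.

Theorem theorem1p5 (k : closedFieldType) (V : vectType k) (n : nat)
    (hn : (3 <= n)%N) (hV : \dim {:V} = n)
    (hchar : [pchar k] =i pred0 \/
             exists2 p : nat, p \in [pchar k] & (n - 2 <= p)%N)
    (K : {vspace ext2 V}) :
  Chow K <->
  \dim K = (2 * n - 3)%N /\
  (tensv K {:sym (n - 3) V} :&: lker (delta2 V (n - 3)))%VS <> 0%VS.
Proof.
subst n; set q := (\dim {:V} - 3)%N.
have char_q i : (0 < i <= q)%N -> i%:R != 0 :> k.
  move=> /andP[i0 iq]; case: hchar => [/pcharf0P ->|[p pk hp]]; first by rewrite -lt0n.
  (* Here i <= n - 3 < n - 2 <= p, so p does not divide i. *)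
  rewrite -(dvdn_pcharf pk) gtnNdvd //; apply: leq_ltn_trans iq _.
  by apply: leq_trans hp; rewrite /q; move: hn; lia.
split=> [/ChowP[dK [xi [eta [nz hK]]]]|[dK nz]].
  by split=> //; apply: (chow_kernel _ dK nz hK); rewrite /q; move: hn; lia.
apply: NNPP => nC; apply: nz; apply/eqP; rewrite -subv0; apply/subvP => t.
rewrite memv_cap memv_ker memv0 => /andP[tK /eqP dt].
by rewrite (koszul_injective hn char_q dK nC tK dt).
Qed.
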